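(* Let $R$ be a henselian local ring that is not Gorenstein. Suppose that there is a nonfree cyclic totally reflexive $R$-module. Then there are infinitely many isomorphism classes of indecomposable totally reflexive $R$-modules.
   Context: All rings are commutative and noetherian, and all modules are finitely generated. For an $R$-module $M$ write $M^{\ast}=\operatorname{Hom}_R(M,R)$. An $R$-module $M$ is called totally reflexive (or of G-dimension zero) if the natural homomorphism $M\to M^{\ast\ast}$ is an isomorphism and $\operatorname{Ext}_R^i(M,R)=\operatorname{Ext}_R^i(M^{\ast},R)=0$ for all $i>0$. *)

(* Defs.v *)
From HB Require Import structures.
From mathcomp Require Import all_boot all_algebra boolp.

Set Implicit Arguments.
Unset Strict Implicit.
Unset Printing Implicit Defensive.

Import GRing.Theory.
Local Open Scope ring_scope.

Section HomModule.
Variables (R : comNzRingType) (M N : lmodType R).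
Implicit Types f g h : {linear M -> N}.

Lemma linear_ext f g : f =1 g -> f = g.
Proof.
case: f g => [f cf] [g cg] /= /funext fg; move: fg cf cg => -> cf cg.
congr (GRing.Linear.Pack _).
case: cf cg => [[a] [b]] [[c] [d]].
by rewrite (Prop_irrelevance a c) (Prop_irrelevance b d).
Qed.

HB.instance Definition _ := gen_eqMixin {linear M -> N}.
HB.instance Definition _ := gen_choiceMixin {linear M -> N}.

Definition lin0 : {linear M -> N} := \0.
Definition linD f g : {linear M -> N} := f \+ g.
Definition linN f : {linear M -> N} := \- f.
Definition linZ (a : R) f : {linear M -> N} := a \*: f.

Lemma linDA : associative linD.
Proof. by move=> f g h; apply: linear_ext => x /=; rewrite addrA. Qed.
Lemma linDC : commutative linD.
Proof. by move=> f g; apply: linear_ext => x /=; rewrite addrC. Qed.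
Lemma lin0D : left_id lin0 linD.
Proof. by move=> f; apply: linear_ext => x /=; rewrite add0r. Qed.
Lemma linND : left_inverse lin0 linN linD.
Proof. by move=> f; apply: linear_ext => x /=; rewrite addNr. Qed.

HB.instance Definition _ :=
  GRing.isZmodule.Build {linear M -> N} linDA linDC lin0D linND.

Lemma linZA a b f : linZ a (linZ b f) = linZ (a * b) f.
Proof. by apply: linear_ext => x /=; rewrite scalerA. Qed.
Lemma lin1Z : left_id 1 linZ.
Proof. by move=> f; apply: linear_ext => x /=; rewrite scale1r. Qed.
Lemma linZDr : right_distributive linZ +%R.
Proof. by move=> a f g; apply: linear_ext => x /=; rewrite scalerDr. Qed.
Lemma linZDl f : {morph linZ^~ f : a b / a + b}.
Proof. by move=> a b; apply: linear_ext => x /=; rewrite scalerDl. Qed.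

HB.instance Definition _ :=
  GRing.Zmodule_isLmodule.Build R {linear M -> N} linZA lin1Z linZDr linZDl.

End HomModule.

Section Bidual.
Variable R : comNzRingType.

Definition dual (M : lmodType R) : lmodType R := {linear M -> R^o}.

Section Evaluation.
Variables (M : lmodType R) (x : M).

Definition evaluation (phi : dual M) : R^o := (phi : {linear M -> R^o}) x.

Lemma evaluation_linear : linear evaluation. Proof. by []. Qed.

HB.instance Definition _ :=
  GRing.isLinear.Build R (dual M) R^o *:%R evaluation evaluation_linear.
End Evaluation.

Definition biduality (M : lmodType R) (x : M) : dual (dual M) :=
  evaluation x : {linear dual M -> R^o}.

End Bidual.

Section Modules.
Variable R : comNzRingType.
Implicit Types M N : lmodType R.

Definition surjective (A B : Type) (f : A -> B) := forall y, exists x, f x = y.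

Definition exact_at (A B C : lmodType R)
    (f : {linear A -> B}) (g : {linear B -> C}) :=
  forall y, g y = 0 <-> exists x, f x = y.

Definition zero_module M := forall x : M, x = 0.

Definition isomorphic M N := exists f : {linear M -> N}, bijective f.

Definition finitely_generated M :=
  exists (n : nat) (g : 'I_n -> M),
    forall x, exists c : 'I_n -> R, x = \sum_i c i *: g i.

Definition cyclic_module M := exists g : M, forall x, exists a : R, x = a *: g.

(* Free of finite rank; the zero module is free of rank 0. *)
Definition free_module M := exists n : nat, isomorphic M 'rV[R]_n.

Definition indecomposable M :=
  ~ zero_module M /\
  forall N1 N2 : lmodType R,
    isomorphic M (N1 * N2)%type -> zero_module N1 \/ zero_module N2.

Definition projective M :=
  forall (A B : lmodType R) (p : {linear A -> B}) (f : {linear M -> B}),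
    surjective p -> exists g : {linear M -> A}, forall x, p (g x) = f x.

Definition injective_module M :=
  forall (A B : lmodType R) (j : {linear A -> B}) (f : {linear A -> M}),
    injective j -> exists g : {linear B -> M}, forall x, g (j x) = f x.

Definition projective_resolution M (P : nat -> lmodType R)
    (d : forall i, {linear P i.+1 -> P i}) (e : {linear P 0%N -> M}) :=
  [/\ forall i, projective (P i), surjective e, exact_at (d 0%N) e
    & forall i, exact_at (d i.+1) (d i)].

Definition injective_resolution M (I : nat -> lmodType R)
    (e : {linear M -> I 0%N}) (d : forall i, {linear I i -> I i.+1}) :=
  [/\ forall i, injective_module (I i), injective e, exact_at e (d 0%N)
    & forall i, exact_at (d i) (d i.+1)].

(* Ext^i(M, N) = 0. In degree i + 1 this says that Hom(P, N) is exact at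
   Hom(P_(i+1), N) for a projective resolution P of M, the choice of which is
   immaterial; in degree 0, Ext^0(M, N) = Hom(M, N). *)
Definition Ext_eq0 (i : nat) M N : Prop :=
  match i with
  | 0 => zero_module {linear M -> N}
  | j.+1 =>
    exists (P : nat -> lmodType R) (d : forall i, {linear P i.+1 -> P i})
        (e : {linear P 0%N -> M}),
      projective_resolution d e /\
      forall phi : {linear P j.+1 -> N}, (forall x, phi (d j.+1 x) = 0) ->
        exists psi : {linear P j -> N}, forall x, phi x = psi (d j x)
  end.

Definition totally_reflexive M :=
  [/\ finitely_generated M,
      bijective (@biduality R M),
      forall i, (0 < i)%N -> Ext_eq0 i M R^o
    & forall i, (0 < i)%N -> Ext_eq0 i (dual M) R^o].

Definition finite_injective_dimension M :=
  exists (I : nat -> lmodType R) (e : {linear M -> I 0%N})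
      (d : forall i, {linear I i -> I i.+1}),
    injective_resolution e d /\
    exists n, forall i, (n < i)%N -> zero_module (I i).

End Modules.

Section Rings.
Variable R : comNzRingType.

(* The ideals of R are the submodules of R^o. *)
Definition noetherian :=
  forall I : {pred R^o}, submod_closed I ->
    exists (n : nat) (g : 'I_n -> R),
      forall x : R, x \in I <-> exists c : 'I_n -> R, x = \sum_i c i * g i.

(* idealr_closed includes properness. *)
Definition maximal_ideal (m : {pred R}) :=
  idealr_closed m /\
  forall J : {pred R}, idealr_closed J -> {subset m <= J} -> {subset J <= m}.

Definition local_ring :=
  exists m : {pred R},
    maximal_ideal m /\ forall m' : {pred R}, maximal_ideal m' -> m' =i m.

(* Hensel's lemma holds in R: coprime monic factorizations over the residue
   field lift. As R is local, a surjective morphism from R onto a field is,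
   up to isomorphism, the projection onto the residue field. *)
Definition henselian_local_ring :=
  local_ring /\
  forall (k : fieldType) (pi : {rmorphism R -> k}), surjective pi ->
  forall (f : {poly R}) (g0 h0 : {poly k}),
    f \is monic -> g0 \is monic -> h0 \is monic -> coprimep g0 h0 ->
    map_poly pi f = g0 * h0 ->
    exists g h : {poly R},
      [/\ g \is monic, h \is monic, f = g * h,
          map_poly pi g = g0 & map_poly pi h = h0].

(* Meant for noetherian local rings. *)
Definition gorenstein := finite_injective_dimension (R^o : lmodType R).

End Rings.

(* Main.v *)
From HB Require Import structures.
From mathcomp Require Import all_boot all_order all_algebra.
From mathcomp Require Import boolp ring.
From mathcomp Require classical_sets.
Require Import Defs.

(** Suppose that there are only finitely many indecomposable totally reflexive
    modules, and let k be the residue field. Then some f : X -> k with X totally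
    reflexive has the property that every map G -> k with G totally reflexive
    factors through f. Hensel's lemma gives Fitting decompositions of
    endomorphisms, so f can be taken right minimal; by Wakamatsu's lemma
    Y = ker f then satisfies Ext^1(G, Y) = 0 for all totally reflexive G.

    Let P be the minimal free resolution of a nonfree totally reflexive module,
    with syzygies G_n. As G_(n+1) lies in m P_n, a map P_n -> X sends it into Y,
    and restriction gives exact sequences
      0 -> Hom(G_n, Y) -> Hom(P_n, X) -> Hom(G_(n+1), Y) + Hom(P_n, k) -> 0.
    Since Ext^i(X, R) = 0 for i > 0, they yield surjections
    Ext^n(Hom(G_n, Y), R) -> Ext^(n+1)(Hom(G_(n+1), Y), R) whose kernel is a
    nonzero power of Ext^(n+1)(k, R). All but finitely many of them are
    bijective because Hom(Hom(G_0, Y), R) is noetherian, so Ext^n(k, R) = 0 for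
    large n, and R is Gorenstein. *)

Set Implicit Arguments.
Unset Strict Implicit.
Unset Printing Implicit Defensive.

Import Order.TTheory GRing.Theory Num.Theory.
Local Open Scope ring_scope.

(** * Submodules and quotient modules *)

Section LinearMaps.
Variable R : comNzRingType.
Implicit Types M N L : lmodType R.

(** Right minimality of f is forced by Wakamatsu's argument, which yields an endomorphism of X
    compatible with f that has to be invertible; Hensel's lemma enters only there. Nonfreeness makes
    the minimal resolution infinite, so every P_n is nonzero and Hom(P_n, k) has k as a summand,
    which turns bijectivity into vanishing of Ext(k, R). Ext modules themselves are never formed. A
    fixed injective resolution of R with cosyzygies [Cz n] represents a class in Ext^n(-, R), n > 0,
    by a map into [Cz n], trivial when it lifts to the injective module before it; long exact
    sequences become extensions and lifts of maps. Consequently connecting maps are relations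
    between such cocycles, Nakayama's lemma for Ext is moved by dimension shifting to a finitely
    generated Hom module, and finite injective dimension is reached by proving a cosyzygy of R
    injective through Baer's criterion. *)

Definition mklin M N (f : M -> N) (fL : linear f) : {linear M -> N} :=
  HB.pack f (GRing.isLinear.Build R M N *:%R f fL).

Lemma linear_of M N (f : M -> N) :
  linear f -> exists g : {linear M -> N}, forall x, g x = f x.
Proof. by move=> fL; exists (mklin fL). Qed.

Lemma linear_inj M N (f : {linear M -> N}) :
  (forall x, f x = 0 -> x = 0) -> injective f.
Proof.
by move=> f0 x y fxy; apply/subr0_eq/f0; rewrite linearB fxy subrr.
Qed.

Lemma injective_eq0 M N (f : {linear M -> N}) x :
  injective f -> f x = 0 -> x = 0.
Proof. by move=> fI; rewrite -[RHS](linear0 f) => /fI. Qed.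

Lemma descend M N L (p : {linear M -> N}) (f : {linear M -> L}) :
  surjective p -> (forall x, p x = 0 -> f x = 0) ->
  exists g : {linear N -> L}, forall x, g (p x) = f x.
Proof.
move=> pS pf; have [s sK] := choice pS.
have fE x y : p x = p y -> f x = f y.
  by move=> /eqP; rewrite -subr_eq0 -linearB => /eqP/pf/eqP;
     rewrite linearB subr_eq0 => /eqP.
have [|g gE] := @linear_of _ _ (fun y => f (s y)).
  by move=> a x y; rewrite -linearP; apply: fE; rewrite linearP !sK.
by exists g => x; rewrite gE; apply: fE; rewrite sK.
Qed.

Lemma lift_inj M N L (i : {linear M -> N}) (f : {linear L -> N}) :
  injective i -> (forall x, exists y, i y = f x) ->
  exists g : {linear L -> M}, forall x, i (g x) = f x.
Proof.
move=> iI /choice[s sK].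
have [|g gE] := @linear_of _ _ s.
  by move=> a x y; apply: iI; rewrite linearP !sK linearP.
by exists g => x; rewrite gE sK.
Qed.

Definition submod M (S : M -> Prop) :=
  S 0 /\ forall a x y, S x -> S y -> S (a *: x + y).

Section SubmodTheory.
Variables (M : lmodType R) (S : M -> Prop) (SS : submod S).
Lemma submod0 : S 0. Proof. by case: SS. Qed.
Lemma submodD x y : S x -> S y -> S (x + y).
Proof. by move=> Sx Sy; rewrite -[x]scale1r; apply: (SS.2). Qed.
Lemma submodZ a x : S x -> S (a *: x).
Proof. by move=> Sx; rewrite -[_ *: _]addr0; apply: (SS.2) => //; case: SS. Qed.
Lemma submodN x : S x -> S (- x).
Proof. by rewrite -scaleN1r; apply: submodZ. Qed.
Lemma submodB x y : S x -> S y -> S (x - y).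
Proof. by move=> Sx Sy; apply: submodD => //; apply: submodN. Qed.
Lemma submod_sum (I : Type) (r : seq I) (P : pred I) (F : I -> M) :
  (forall i, P i -> S (F i)) -> S (\sum_(i <- r | P i) F i).
Proof. by move=> SF; elim/big_ind: _ => //; [apply: submod0 | apply: submodD]. Qed.
End SubmodTheory.

Lemma submod_ker M N (f : {linear M -> N}) : submod (fun x => f x = 0).
Proof.
by split=> [|a x y fx fy]; rewrite ?linear0 // linearP fx fy scaler0 addr0.
Qed.

Lemma submod_img M N (f : {linear M -> N}) : submod (fun y => exists x, f x = y).
Proof.
split=> [|a _ _ [x <-] [y <-]]; first by exists 0; rewrite linear0.
by exists (a *: x + y); rewrite linearP.
Qed.

Section Submodule.
Variables (M : lmodType R) (S : M -> Prop) (SS : submod S).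

Definition submod_pred : {pred M} := fun x => `[< S x >].

Lemma submod_pred_closed : submod_closed submod_pred.
Proof.
split=> [|a x y /asboolP Sx /asboolP Sy]; apply/asboolP.
  exact: submod0.
by apply: (SS.2).
Qed.

HB.instance Definition _ := GRing.isSubmodClosed.Build R M submod_pred
  (GRing.submod_closed_semi submod_pred_closed).

Definition submod_type := {x : M | submod_pred x}.
HB.instance Definition _ := Choice.on submod_type.
HB.instance Definition _ := SubChoice.on submod_type.
HB.instance Definition _ := [SubChoice_isSubLmodule of submod_type by <:].

Lemma submodule_exists : exists (K : lmodType R) (i : {linear K -> M}),
  injective i /\ forall x, S x <-> exists k, i k = x.
Proof.
have [|i iE] := @linear_of submod_type M val; first by [].
exists submod_type, i; split=> [x y|x]; first by rewrite !iE => /val_inj.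
split=> [Sx|[k <-]]; last by rewrite iE; apply/asboolP/(valP k).
have Sx' : submod_pred x by apply/asboolP.
by exists (exist _ x Sx'); rewrite iE.
Qed.
End Submodule.

Section Quotient.
Variables (M : lmodType R) (S : M -> Prop) (SS : submod S).
Local Open Scope quotient_scope.

Definition quot_eqv (x y : M) := `[< S (x - y) >].

Lemma quot_eqvP : equiv_class_of quot_eqv.
Proof.
split=> [x|x y|y x z]; rewrite /quot_eqv.
- by apply/asboolP; rewrite subrr; apply: submod0.
- by apply: asbool_equiv_eq; split=> /(submodN SS); rewrite opprB.
- move=> /asboolP xy /asboolP yz; apply/asboolP.
  by rewrite -(subrKA y); apply: submodD.
Qed.

Canonical quot_equiv := EquivRelPack quot_eqvP.
Definition quot_type := {eq_quot quot_equiv}.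
HB.instance Definition _ := Choice.on quot_type.
HB.instance Definition _ := EqQuotient.on quot_type.

Definition qpi (x : M) : quot_type := \pi_quot_type x.

Lemma qpiK y : qpi (repr y) = y. Proof. exact: reprK. Qed.

Lemma quot_piP (x y : M) :
  qpi x = qpi y <-> S (x - y).
Proof. by split=> [/eqmodP/asboolP//|Sxy]; apply/eqmodP/asboolP. Qed.

Definition quot0 : quot_type := qpi 0.
Definition quotN (x : quot_type) : quot_type := qpi (- repr x).
Definition quotD (x y : quot_type) : quot_type := qpi (repr x + repr y).
Definition quotZ (a : R) (x : quot_type) : quot_type := qpi (a *: repr x).

Lemma repr_pi (x : M) : S (repr (qpi x) - x).
Proof. by apply/quot_piP; rewrite qpiK. Qed.

Lemma pi_quotD (x y : M) : quotD (qpi x) (qpi y) = qpi (x + y).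
Proof.
by apply/quot_piP; rewrite opprD addrACA; apply: submodD => //; apply: repr_pi.
Qed.
Lemma pi_quotN (x : M) : quotN (qpi x) = qpi (- x).
Proof.
by apply/quot_piP; rewrite -opprD; apply: submodN => //; apply: repr_pi.
Qed.
Lemma pi_quotZ a (x : M) : quotZ a (qpi x) = qpi (a *: x).
Proof.
by apply/quot_piP; rewrite -scalerBr; apply: submodZ => //; apply: repr_pi.
Qed.

Lemma quotDA : associative quotD.
Proof.
move=> x y z; rewrite -[x]qpiK -[y]qpiK -[z]qpiK.
by rewrite !pi_quotD addrA.
Qed.
Lemma quotDC : commutative quotD.
Proof. by move=> x y; rewrite -[x]qpiK -[y]qpiK !pi_quotD addrC. Qed.
Lemma quot0D : left_id quot0 quotD.
Proof. by move=> x; rewrite -[x]qpiK pi_quotD add0r. Qed.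
Lemma quotND : left_inverse quot0 quotN quotD.
Proof. by move=> x; rewrite -[x]qpiK pi_quotN pi_quotD addNr. Qed.

HB.instance Definition _ :=
  GRing.isZmodule.Build quot_type quotDA quotDC quot0D quotND.

Lemma quotZA a b x : quotZ a (quotZ b x) = quotZ (a * b) x.
Proof. by rewrite -[x]qpiK !pi_quotZ scalerA. Qed.
Lemma quot1Z : left_id 1 quotZ.
Proof. by move=> x; rewrite -[x]qpiK pi_quotZ scale1r. Qed.
Lemma quotZDr : right_distributive quotZ +%R.
Proof.
move=> a x y; rewrite -[x]qpiK -[y]qpiK.
rewrite [qpi _ + _]pi_quotD !pi_quotZ scalerDr.
exact: (esym (pi_quotD _ _)).
Qed.
Lemma quotZDl x : {morph quotZ^~ x : a b / a + b}.
Proof.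
move=> a b /=; rewrite -[x]qpiK !pi_quotZ scalerDl.
exact: (esym (pi_quotD _ _)).
Qed.

HB.instance Definition _ :=
  GRing.Zmodule_isLmodule.Build R quot_type quotZA quot1Z quotZDr quotZDl.

Lemma quotient_exists : exists (Q : lmodType R) (q : {linear M -> Q}),
  surjective q /\ forall x, q x = 0 <-> S x.
Proof.
have [|q qE] := @linear_of M quot_type qpi.
  move=> a x y; rewrite -[RHS]/(quotD (quotZ a (qpi x)) (qpi y)).
  by rewrite pi_quotZ pi_quotD.
exists quot_type, q; split=> [y|x]; first by exists (repr y); rewrite qE qpiK.
by rewrite qE -[0]/quot0 quot_piP subr0.
Qed.
End Quotient.
End LinearMaps.

Section Pairs.
Variables (R : comNzRingType) (M N : lmodType R).
Implicit Types (x y : M) (u v : N).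
Lemma pairD x y u v : (x, u) + (y, v) = (x + y, u + v). Proof. by []. Qed.
Lemma pairN x u : - (x, u) = (- x, - u). Proof. by []. Qed.
Lemma pairZ a x u : a *: ((x, u) : (M * N)%type) = (a *: x, a *: u).
Proof. by []. Qed.
End Pairs.

(** * Baer's criterion and enough injectives *)

Section Baer.
Variable R : comNzRingType.

Definition baer (E : lmodType R) :=
  forall (A : lmodType R) (i : {linear A -> R^o}) (f : {linear A -> E}),
    injective i -> exists g : {linear R^o -> E}, forall x, g (i x) = f x.

Section Extension.
Variables (E A B : lmodType R) (j : {linear A -> B}) (f : {linear A -> E}).
Hypotheses (Ebaer : baer E) (jI : injective j).

(* A partial linear map from B to E, given by its graph. *)
Definition partial_map (S : (B * E)%type -> Prop) :=
  submod S /\ forall y, S (0, y) -> y = 0.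

Definition graph_of (z : (B * E)%type) := exists a, z = (j a, f a).

Lemma graph_of_partial : partial_map graph_of.
Proof.
split=> [|y [a [/esym ja ->]]]; last first.
  by rewrite (injective_eq0 jI ja) linear0.
split=> [|r _ _ [a ->] [b ->]]; first by exists 0; rewrite !linear0.
by exists (r *: a + b); rewrite !linearP.
Qed.

Lemma partial_map_fun S b y y' : partial_map S -> S (b, y) -> S (b, y') -> y = y'.
Proof.
move=> [SS S0] Sy Sy'; apply/subr0_eq/S0.
by have := submodB SS Sy Sy'; rewrite pairN pairD subrr.
Qed.

Lemma maximal_partial_map : exists S : (B * E)%type -> Prop,
  [/\ partial_map S, forall a, S (j a, f a) &
   forall S', partial_map S' -> (forall z, S z -> S' z) -> forall z, S' z -> S z].
Proof.
(* Zorn's lemma covers the empty chain too, whose union is empty and so no submodule; adjoining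
   [graph_of] to [S] repairs this and makes the maximal element extend [f]. *)
pose P (S : (B * E)%type -> Prop) := partial_map (fun z => S z \/ graph_of z).
have [F FP Ftot|S [PS Smax]] := @classical_sets.Zorn_bigcup _ P; last first.
  exists (fun z => S z \/ graph_of z); split=> // [a|S' PS' SS' z S'z].
    by right; exists a.
  have [Sz|nSz] := pselect (S z); [by left | exfalso]; apply: (Smax S').
    by split=> [t St|S'S]; [apply: SS'; left | apply/nSz/S'S].
  rewrite /P; suff -> : (fun t => S' t \/ graph_of t) = S' by [].
  apply/funext => t; apply/propext; split=> [[//|Gt]|]; last by left.
  by apply: SS'; right.
have [GS G0] := graph_of_partial.
split; first split.
- by right; apply: (submod0 GS).
- move=> a x y [[X FX Xx]|Gx] [[Y FY Yy]|Gy].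
  + have [Z [FZ Zx Zy]] : exists Z, [/\ F Z, Z x & Z y].
      by have [XY|YX] := Ftot _ _ FX FY; [exists Y | exists X]; split; auto.
    have [[_ /(_ a x y)]] := FP _ FZ.
    by case; [left | left | left; exists Z | right].
  + have [[_ /(_ a x y)]] := FP _ FX.
    by case; [left | right | left; exists X | right].
  + have [[_ /(_ a x y)]] := FP _ FY.
    by case; [right | left | left; exists Y | right].
  + by right; apply: (GS.2).
- move=> y [[X FX Xy]|/G0//].
  by have [_ /(_ y)] := FP _ FX; apply; left.
Qed.

(** On the multiples of [b] in its domain, a maximal [S] is a linear map on the ideal [I]. Baer's
    condition extends that map to [g] on R, and adding the pairs (r b, g r) to [S] stays single
    valued because [g] agrees with [S] on [I]; by maximality [b] was in the domain. *)
Lemma baer_extension : exists g : {linear B -> E}, forall x, g (j x) = f x.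
Proof.
have [S [PS GS Smax]] := maximal_partial_map; have [SS S0] := PS.
suff /choice[g gS] : forall b, exists y, S (b, y).
  have [|h hE] := @linear_of _ _ _ g.
    move=> a x y; apply: (partial_map_fun PS (gS _)).
    exact: ((SS.2) a (_, _) (_, _) (gS x) (gS y)).
  by exists h => x; rewrite hE; apply: (partial_map_fun PS (gS _)).
move=> b; pose I (r : R^o) := exists y, S (r *: b, y).
have IS : submod I.
  split=> [|a r s [x Sx] [y Sy]].
    by exists 0; rewrite scale0r; apply: (submod0 SS).
  exists (a *: x + y); rewrite scalerDl -scalerA.
  exact: ((SS.2) a (_, _) (_, _) Sx Sy).
have [K [i [iI iE]]] := submodule_exists IS.
have [|s sS] := @choice K E (fun k y => S (i k *: b, y)).
  by move=> k; apply/iE; exists k.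
have [|f' f'E] := @linear_of _ K E s.
  move=> a x y; apply: (partial_map_fun PS (sS _)).
  rewrite linearP scalerDl -scalerA.
  exact: ((SS.2) a (_, _) (_, _) (sS x) (sS y)).
have [g gE] := Ebaer f' iI.
have gS r : I r -> S (r *: b, g r).
  by move=> /iE[k <-]; rewrite gE f'E.
pose S' (z : (B * E)%type) :=
  exists (r : R^o) d, S d /\ z = d + (r *: b, g r).
exists (g 1); apply: (Smax S'); last first.
- exists 1, 0; split; first exact: (submod0 SS).
  by rewrite add0r scale1r.
- move=> z Sz; exists 0, z; split=> //.
  by rewrite scale0r linear0 [(0, 0)](_ : _ = 0) // addr0.
split; first split.
- exists 0, 0; split; first exact: (submod0 SS).
  by rewrite scale0r linear0 [(0, 0)](_ : _ = 0) // addr0.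
- move=> a _ _ [r [d [Sd ->]]] [r' [d' [Sd' ->]]].
  exists (a *: r + r'), (a *: d + d'); split; first exact: (SS.2).
  rewrite linearP scalerDl -scalerA scalerDr addrACA.
  by congr (_ + _).
- move=> y [r [[d y'] [Sd [/esym/eqP]]]].
  rewrite addr_eq0 => /eqP dE ->; rewrite dE in Sd.
  have Ir : I r.
    exists (- y'); by have := submodN SS Sd; rewrite pairN opprK.
  have := submodD SS Sd (gS r Ir); rewrite pairD addNr.
  exact: S0.
Qed.

End Extension.

Lemma baer_injective (E : lmodType R) : baer E -> injective_module E.
Proof. by move=> Eb A B j f /(baer_extension f Eb). Qed.
End Baer.

Lemma int_linear_of (U V : lmodType int) (f : U -> V) :
  {morph f : x y / x + y} -> exists g : {linear U -> V}, forall x, g x = f x.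
Proof.
move=> fD.
have f0 : f 0 = 0 by apply: (addIr (f 0)); rewrite -fD !add0r.
have fB : zmod_morphism f.
  move=> x y; apply: (addIr (f y)); rewrite -fD !addrNK //.
pose F : {additive U -> V} := HB.pack f (GRing.isZmodMorphism.Build U V f fB).
have [|g gE] := @linear_of _ U V f; last by exists g.
move=> n x y; rewrite fD; congr (_ + _).
by rewrite -[n]intz !scaler_int -[f _]/(F _) raddfMz.
Qed.

Definition is_integer (x : rat) := exists n : int, x = n%:~R.

Lemma is_integerP x : is_integer x <-> x \is a Num.int.
Proof. by split=> [[n ->]|/intrP//]; rewrite intr_int. Qed.

Lemma submod_integer : @submod int (zmodule rat) is_integer.
Proof.
split=> [|a _ _ [m ->] [n ->]]; first by exists 0.
by exists (m * a + n); rewrite rmorphD rmorphM /= mulrzr.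
Qed.

Lemma int_subgroup_gen (S : int^o -> Prop) : submod S ->
  (forall z, S z -> z = 0) \/
  exists2 n : nat, (0 < n)%N & S n%:Z /\ forall z, S z -> exists c, z = c * n%:Z.
Proof.
move=> SS; have [S0|/existsNP[z /not_implyP[Sz z0]]] :=
  pselect (forall z, S z -> z = 0); [by left | right].
pose P n := (0 < n)%N && `[< S n%:Z >].
have [|n /andP[n0 /asboolP Sn] nmin] := @ex_minnP P.
  exists `|z|%N; rewrite /P absz_gt0; apply/andP; split; first exact/eqP.
  apply/asboolP; rewrite abszE.
  by case: (ger0P z) => _ //; apply: (submodN SS).
exists n => //; split=> // t St; exists (t %/ n%:Z)%Z.
have rE : (t %% n)%Z = t - (t %/ n)%Z * n%:Z.
  by apply/eqP; rewrite eq_sym subr_eq addrC -divz_eq.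
have Sr : S (t %% n)%Z by rewrite rE; apply: submodB => //; apply: submodZ.
have r0 : 0 <= (t %% n)%Z by rewrite modz_ge0 // -lt0n.
suff r00 : (t %% n)%Z = 0 by rewrite {1}(divz_eq t n) r00 addr0.
apply/eqP; rewrite -absz_eq0 -leqn0 leqNgt; apply/negP => rgt.
have := nmin `|(t %% n)%Z|%N; rewrite /P rgt /= gez0_abs // asboolT // => /(_ isT).
rewrite leqNgt => /negP; apply.
by rewrite -ltz_nat gez0_abs // ltz_pmod.
Qed.

(** [D] is Q/Z. Baer's condition over the integers is divisibility, every ideal being principal; a
    character of the subgroup generated by [x] extends to [M] by injectivity. *)
Lemma circle_exists : exists D : lmodType int, injective_module D /\
  forall (M : lmodType int) (x : M), x <> 0 ->
  exists chi : {linear M -> D}, chi x <> 0.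
Proof.
have [D [q [qS qE]]] := quotient_exists submod_integer.
have qZ (n : int) (t : rat) : q (t *~ n) = n *: q t.
  by rewrite -linearZZ.
have Dinj : injective_module D.
  apply: baer_injective => A i f iI.
  have [i0|[n n0 [[a0 a0E] ngen]]] := int_subgroup_gen (submod_img i).
    exists 0 => a; have a0 : a = 0.
      by apply: (injective_eq0 iI); apply: i0; exists a.
    by rewrite a0 !linear0.
  have [t tE] := qS (f a0).
  have [|g gE] := @int_linear_of int^o D (fun r => r *: q (t / n%:R)).
    by move=> r s; rewrite scalerDl.
  exists g => a; have [|c cE] := ngen (i a); first by exists a.
  have -> : a = c *: a0.
    by apply: iI; rewrite linearZZ a0E.
  rewrite gE !linearZZ -tE a0E /= -[_ *: _ in LHS]qZ -qZ; congr (q _).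
  rewrite -mulrzA_C; congr (_ *~ _).
  by rewrite -mulrzr mulfVK // pnatr_eq0 -lt0n.
exists D; split=> // M x x0.
(* The class of [t] is to be the value of the character at [x]: 1/n if [x] has order n, and 1/2 if
   the order is infinite, where any noninteger would do. *)
have [t tN tx] : exists2 t : rat, ~ is_integer t &
    forall n : int, n *: x = 0 -> is_integer (t *~ n).
  have annS : @submod int int^o (fun n => n *: x = 0).
    split=> [|a m n mx nx]; first by rewrite scale0r.
    by rewrite scalerDl -scalerA mx nx scaler0 addr0.
  have [H|[n n0 [nx ngen]]] := int_subgroup_gen annS.
  - exists 2^-1; first by move/is_integerP; rewrite Qint_def.
    by move=> n /H ->; exists 0.
  - exists n%:R^-1.
      move=> [m mE]; apply: x0; suff n1 : n = 1%N by rewrite n1 scale1r in nx.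
      have : m * n%:Z = 1.
        apply: (@intr_inj rat); rewrite rmorphM /= -mE mulVf //.
        by rewrite pnatr_eq0 -lt0n.
      move=> /(congr1 absz); rewrite abszM /= => /eqP.
      by rewrite muln_eq1 => /andP[_ /eqP].
    move=> z /ngen[c ->]; exists c.
    rewrite -mulrzr.
    by rewrite intrM mulrCA mulVf ?mulr1 // pnatr_eq0 -lt0n.
have [|l lE] := @int_linear_of int^o M (fun n => n *: x).
  by move=> r s; rewrite scalerDl.
have [|h hE] := @int_linear_of int^o D (fun n => n *: q t).
  by move=> r s; rewrite scalerDl.
have [K [i [iI iE]]] := submodule_exists (submod_img l).
have [|p pE] := lift_inj (f := l) iI.
  by move=> n; apply/iE; exists n.
have pS : surjective p.
  move=> y; have /iE[n nE] : exists k, i k = i y by exists y.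
  by exists n; apply: iI; rewrite pE.
have [|g gE] := descend (f := h) pS.
  move=> n pn; rewrite hE -qZ; apply/qE/tx.
  by rewrite -lE -pE pn linear0.
have [chi chiE] := Dinj _ _ i g iI.
exists chi; have -> : x = i (p 1) by rewrite pE lE scale1r.
by rewrite chiE gE hE scale1r => /qE.
Qed.

Section Coinduced.
Variables (R : comNzRingType) (S : Type) (D : lmodType int).

(* The product of copies of Hom_Z(R, D) indexed by S. *)
Record coind := Coind {
  coind_val :> S -> R -> D;
  coindD : forall s a b, coind_val s (a + b) = coind_val s a + coind_val s b }.

HB.instance Definition _ := gen_eqMixin coind.
HB.instance Definition _ := gen_choiceMixin coind.

Lemma coind_ext (f g : coind) : (forall s a, f s a = g s a) -> f = g.
Proof.
case: f g => [f fD] [g gD] /= fg.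
have fE : f = g by apply/funext => s; apply/funext => a.
by subst g; rewrite (Prop_irrelevance fD gD).
Qed.

Program Definition coind0 := @Coind (fun _ _ => 0) _.
Next Obligation. by rewrite addr0. Qed.
Program Definition coindN (f : coind) := @Coind (fun s a => - f s a) _.
Next Obligation. by rewrite coindD opprD. Qed.
Program Definition coind_add (f g : coind) := @Coind (fun s a => f s a + g s a) _.
Next Obligation. by rewrite !coindD addrACA. Qed.
Program Definition coindZ (r : R) (f : coind) := @Coind (fun s a => f s (a * r)) _.
Next Obligation. by rewrite mulrDl coindD. Qed.

Lemma coind_addA : associative coind_add.
Proof. by move=> f g h; apply: coind_ext => s a /=; rewrite addrA. Qed.
Lemma coind_addC : commutative coind_add.
Proof. by move=> f g; apply: coind_ext => s a /=; rewrite addrC. Qed.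
Lemma coind_add0 : left_id coind0 coind_add.
Proof. by move=> f; apply: coind_ext => s a /=; rewrite add0r. Qed.
Lemma coind_addN : left_inverse coind0 coindN coind_add.
Proof. by move=> f; apply: coind_ext => s a /=; rewrite addNr. Qed.
HB.instance Definition _ :=
  GRing.isZmodule.Build coind coind_addA coind_addC coind_add0 coind_addN.

Lemma coindZA a b f : coindZ a (coindZ b f) = coindZ (a * b) f.
Proof. by apply: coind_ext => s c /=; rewrite mulrA. Qed.
Lemma coind1Z : left_id 1 coindZ.
Proof. by move=> f; apply: coind_ext => s c /=; rewrite mulr1. Qed.
Lemma coindZDr : right_distributive coindZ +%R.
Proof. by move=> a f g; apply: coind_ext. Qed.
Lemma coindZDl f : {morph coindZ^~ f : a b / a + b}.
Proof. by move=> a b; apply: coind_ext => s c /=; rewrite mulrDr coindD. Qed.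
HB.instance Definition _ :=
  GRing.Zmodule_isLmodule.Build R coind coindZA coind1Z coindZDr coindZDl.

(** By adjunction a linear map into [coind] is a family of additive maps into [D], obtained by
    evaluating at 1; each of them extends separately, and [g] is rebuilt from the extensions. *)
Lemma coind_injective : injective_module D -> injective_module coind.
Proof.
move=> Dinj A B j f jI.
have ext s : exists h : {linear zmodule B -> D}, forall a, h (j a) = f a s 1.
  have [|j' j'E] := @int_linear_of (zmodule A) (zmodule B) j.
    by move=> x y; rewrite linearD.
  have [|f' f'E] := @int_linear_of (zmodule A) D (fun a => f a s 1).
    by move=> x y; rewrite linearD.
  have [|h hE] := Dinj _ _ j' f'; first by move=> x y; rewrite !j'E => /jI.
  by exists h => a; rewrite -j'E hE f'E.
have [h hE] := choice ext.
have hD s (x y : B) : h s (x + y) = h s x + h s y := linearD (h s) x y.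
have gD (b : B) s (x y : R) : h s ((x + y) *: b) = h s (x *: b) + h s (y *: b).
  by rewrite scalerDl hD.
have [|g gE] := @linear_of _ B coind (fun b => Coind (gD b)).
  move=> r x y; apply: coind_ext => s a /=.
  by rewrite scalerDr scalerA hD.
exists g => a; rewrite gE; apply: coind_ext => s r /=.
by rewrite -linearZZ hE linearZZ /= mul1r.
Qed.
End Coinduced.

Section EnoughInjectives.
Variable R : comNzRingType.

(** The product is indexed by all characters of [M], so [j] is injective because characters separate
    points. *)
Lemma enough_injectives (M : lmodType R) :
  exists (E : lmodType R) (j : {linear M -> E}), injective_module E /\ injective j.
Proof.
have [D [Dinj Dcog]] := circle_exists.
pose S := {linear zmodule M -> D}.
have jD (x : M) (s : S) (a b : R) : s ((a + b) *: x) = s (a *: x) + s (b *: x).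
  by rewrite scalerDl; apply: (linearD s).
have [|j jE] := @linear_of _ M (coind R S D) (fun x => Coind (jD x)).
  move=> r x y; apply: coind_ext => s a /=.
  by rewrite scalerDr scalerA; apply: (linearD s).
exists (coind R S D), j; split; first exact: coind_injective.
apply: linear_inj => x; rewrite jE => jx0; apply: contrapT => x0.
have [chi] := Dcog (zmodule M) x x0; apply.
by have := congr1 (fun F : coind R S D => F chi 1) jx0; rewrite /= scale1r.
Qed.

Lemma injective_cosyzygy (M : lmodType R) :
  exists (E C : lmodType R) (j : {linear M -> E}) (q : {linear E -> C}),
  [/\ injective_module E, injective j, surjective q & exact_at j q].
Proof.
have [E [j [Einj jI]]] := enough_injectives M.
have [C [q [qS qE]]] := quotient_exists (submod_img j).
by exists E, C, j, q; split=> // y; rewrite qE.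
Qed.
End EnoughInjectives.

(** * Ext(-, R) through an injective resolution of R *)

Section Cosyzygies.
Variable R : comNzRingType.
Implicit Types A B C M N L : lmodType R.

Record cosyzygy M := Cosyzygy {
  cosyz_inj : lmodType R;
  cosyz_mod : lmodType R;
  cosyz_j : {linear M -> cosyz_inj};
  cosyz_q : {linear cosyz_inj -> cosyz_mod};
  cosyz_injP : injective_module cosyz_inj;
  cosyz_jI : injective cosyz_j;
  cosyz_qS : surjective cosyz_q;
  cosyz_ex : exact_at cosyz_j cosyz_q }.

Lemma cosyzygy_exists M : exists c : cosyzygy M, True.
Proof.
have [E [C [j [q [Einj jI qS jq]]]]] := injective_cosyzygy M.
by exists (Cosyzygy Einj jI qS jq).
Qed.

Definition cosyz M : cosyzygy M := projT1 (cid (cosyzygy_exists M)).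

(* A fixed injective resolution 0 -> R -> Ez 0 -> Ez 1 -> ... with cosyzygies
   Cz 0 = R, Cz 1, ... *)
Fixpoint Cz (n : nat) : lmodType R :=
  if n is m.+1 then cosyz_mod (cosyz (Cz m)) else R^o.
Definition Ez n : lmodType R := cosyz_inj (cosyz (Cz n)).
Definition jz n : {linear Cz n -> Ez n} := cosyz_j (cosyz (Cz n)).
Definition qz n : {linear Ez n -> Cz n.+1} := cosyz_q (cosyz (Cz n)).

Lemma jzI n : injective (@jz n). Proof. exact: cosyz_jI. Qed.
Lemma qzS n : surjective (@qz n). Proof. exact: cosyz_qS. Qed.
Lemma qjz n x : qz n (jz n x) = 0.
Proof. by apply/cosyz_ex; exists x. Qed.

Lemma Ez_ext n A B (i : {linear A -> B}) (f : {linear A -> Ez n}) :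
  injective i -> exists g : {linear B -> Ez n}, forall x, g (i x) = f x.
Proof. exact: cosyz_injP. Qed.

Lemma Cz_lift n M (f : {linear M -> Ez n}) :
  (forall x, qz n (f x) = 0) -> exists g : {linear M -> Cz n}, forall x, jz n (g x) = f x.
Proof. by move=> qf; apply: lift_inj (@jzI n) _ => x; apply/cosyz_ex/qf. Qed.

(* [van n M] says that Ext^(n+1)(M, R) = 0. *)
Definition van n M := forall f : {linear M -> Cz n.+1},
  exists e : {linear M -> Ez n}, forall x, qz n (e x) = f x.

Definition ses A B C (i : {linear A -> B}) (p : {linear B -> C}) :=
  [/\ injective i, surjective p & exact_at i p].

Definition extends n A B (i : {linear A -> B}) :=
  forall f : {linear A -> Cz n}, exists g : {linear B -> Cz n}, forall x, g (i x) = f x.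

Lemma van_projective n P : projective P -> van n P.
Proof. by move=> Pp f; apply: Pp (@qzS n). Qed.

Lemma van_retract n M L (i : {linear M -> L}) (p : {linear L -> M}) :
  (forall x, p (i x) = x) -> van n L -> van n M.
Proof.
move=> ip Lv f; have [e eE] := Lv (f \o p).
by exists (e \o i) => x /=; rewrite eE /= ip.
Qed.

Section ShortExact.
Variables (A B C : lmodType R) (i : {linear A -> B}) (p : {linear B -> C}).
Hypothesis ip : ses i p.

Let iI : injective i. Proof. by case: ip. Qed.
Let pS : surjective p. Proof. by case: ip. Qed.
Let pi0 x : p (i x) = 0. Proof. by case: ip => _ _ E; apply/E; exists x. Qed.
Let ker y : p y = 0 -> exists x, i x = y.
Proof. by case: ip => _ _ E /E. Qed.

Lemma ses_descend L (f : {linear B -> L}) : (forall x, f (i x) = 0) ->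
  exists g : {linear C -> L}, forall x, g (p x) = f x.
Proof. by move=> fi; apply: (descend pS) => x /ker[a <-]. Qed.

Lemma van_extends n : van n C -> extends n i.
Proof.
move=> Cv f; have [g gE] := Ez_ext (jz n \o f) iI.
have [|h hE] := @ses_descend _ (qz n \o g).
  by move=> x /=; rewrite gE /= qjz.
have [e eE] := Cv h.
have [|k kE] := @Cz_lift n B (g \- (e \o p)).
  by move=> x /=; rewrite linearB eE hE /= subrr.
exists k => x; apply: (@jzI n); rewrite kE /= gE pi0 linear0 subr0 //.
Qed.

Lemma extends_van n : van n B -> extends n i -> van n C.
Proof.
move=> Bv ext f; have [e eE] := Bv (f \o p).
have [|h hE] := @Cz_lift n A (e \o i).
  by move=> x /=; rewrite eE /= pi0 linear0.
have [g gE] := ext h.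
have [|k kE] := @ses_descend _ (e \- (jz n \o g)).
  by move=> x /=; rewrite gE hE subrr.
exists k => y; have [x <-] := pS y.
by rewrite kE /= linearB qjz eE subr0.
Qed.

Lemma van_mid n : van n A -> van n C -> van n B.
Proof.
move=> Av Cv f; have [e eE] := Av (f \o i).
have [g gE] := Ez_ext e iI.
have [|h hE] := @ses_descend _ (f \- (qz n \o g)).
  by move=> x /=; rewrite gE eE subrr.
have [k kE] := Cv h.
by exists ((k \o p) \+ g) => x /=; rewrite linearD kE hE /= subrK.
Qed.

Lemma van_left n : van n.+1 C -> van n B -> van n A.
Proof.
move=> Cv Bv f; have [g gE] := van_extends Cv f.
by have [e eE] := Bv g; exists (e \o i) => x /=; rewrite eE gE.
Qed.

Lemma van_right n : van n A -> van n.+1 B -> van n.+1 C.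
Proof.
move=> Av Bv; apply: (extends_van Bv) => f.
have [e eE] := Av f; have [g gE] := Ez_ext e iI.
by exists (qz n \o g) => x /=; rewrite gE eE.
Qed.
End ShortExact.

Lemma linear_rV s M (f : {linear 'rV[R]_s -> M}) v :
  f v = \sum_i v 0 i *: f (delta_mx 0 i).
Proof.
by rewrite {1}(row_sum_delta v) linear_sum; apply: eq_bigr => i _; rewrite linearZZ.
Qed.

Lemma linear_rV_ext s M (f g : {linear 'rV[R]_s -> M}) :
  (forall i, f (delta_mx 0 i) = g (delta_mx 0 i)) -> forall v, f v = g v.
Proof.
by move=> fg v; rewrite !(linear_rV _ v); apply: eq_bigr => i _; rewrite fg.
Qed.

Lemma rV_linear_of s M (x : 'I_s -> M) :
  exists f : {linear 'rV[R]_s -> M}, forall v, f v = \sum_i v 0 i *: x i.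
Proof.
apply: linear_of => a u v; rewrite scaler_sumr -big_split.
by apply: eq_bigr => i _ /=; rewrite !mxE scalerDl scalerA.
Qed.

Lemma sum_delta s M (x : 'I_s -> M) i :
  \sum_j (delta_mx 0 i : 'rV[R]_s) 0 j *: x j = x i.
Proof.
rewrite (bigD1 i) //= big1 ?addr0 ?mxE ?eqxx ?scale1r // => j /negPf ji.
by rewrite mxE eqxx ji scale0r.
Qed.

Lemma rV_linear_of_delta s M (x : 'I_s -> M) :
  exists f : {linear 'rV[R]_s -> M}, forall i, f (delta_mx 0 i) = x i.
Proof.
by have [f fE] := rV_linear_of x; exists f => i; rewrite fE sum_delta.
Qed.

Lemma projective_rV s : projective 'rV[R]_s.
Proof.
move=> A B p f pS.
have /choice[x xE] : forall i, exists a, p a = f (delta_mx 0 i) by move=> i; apply: pS.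
have [g gE] := rV_linear_of_delta x.
by exists g; apply: (linear_rV_ext (f := p \o g)) => i /=; rewrite gE xE.
Qed.

Lemma van_rV n s : van n 'rV[R]_s.
Proof. exact/van_projective/projective_rV. Qed.

Lemma linear_sumE M N (I : Type) (r : seq I) (h : I -> {linear M -> N}) x :
  (\sum_(i <- r) h i : {linear M -> N}) x = \sum_(i <- r) h i x.
Proof. by elim/big_rec2: _ => //= i y z _ <-. Qed.

Lemma van_hom_rV n s M : van n M -> van n {linear 'rV[R]_s -> M}.
Proof.
move=> Mv f.
have vL i (x : M) : linear (fun v : 'rV[R]_s => v 0 i *: x).
  by move=> a u v; rewrite !mxE scalerDl scalerA.
(* [D i] is the inclusion of the i-th summand when Hom(R^s, M) is seen as M^s; the lift is assembled
   from lifts on the summands. *)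
have /choice[D DE] (i : 'I_s) : exists D : {linear M -> {linear 'rV[R]_s -> M}},
    forall x, D x = mklin (vL i x).
  apply: linear_of => a x y; apply: linear_ext => v /=.
  by rewrite scalerDr !scalerA mulrC.
have /choice[e eE] (i : 'I_s) : exists e : {linear M -> Ez n},
    forall x, qz n (e x) = f (D i x) by apply: (Mv (f \o D i)).
have [|E EE] := @linear_of _ {linear 'rV[R]_s -> M} (Ez n)
    (fun g => \sum_i e i (g (delta_mx 0 i))).
  move=> a g h; rewrite scaler_sumr -big_split; apply: eq_bigr => i _ /=.
  by rewrite -linearP.
exists E => g; rewrite EE linear_sum.
under eq_bigr do rewrite eE.
rewrite -linear_sum; congr (f _); apply: linear_ext => v.
rewrite (linear_rV g v).
by rewrite linear_sumE; apply: eq_bigr => i _; rewrite DE.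
Qed.

Lemma van_regular n : van n R^o.
Proof.
move=> f; have [e eE] := qzS (f 1).
have [|g gE] := @linear_of _ R^o (Ez n) (fun r => r *: e).
  by move=> a r s; rewrite scalerDl scalerA.
by exists g => r; rewrite gE linearZZ eE -linearZZ /= [_ *: _]mulr1.
Qed.

Lemma van_dual_rV n s : van n (dual 'rV[R]_s).
Proof. exact: (@van_hom_rV n s R^o (@van_regular n)). Qed.

End Cosyzygies.

(** * Finitely generated modules *)

Section Span.
Variable R : comNzRingType.
Implicit Types A B C M N L : lmodType R.

(** Recursion on the list lets later inductions split off one generator and keep the span of the
    rest. *)
Fixpoint span M (l : seq M) (x : M) : Prop :=
  if l is g :: l' then exists r : R, span l' (x - r *: g) else x = 0.

Lemma submod_span M (l : seq M) : submod (span l).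
Proof.
elim: l => [|g l [IH0 IHl]] /=; split=> //.
- by move=> a x y -> ->; rewrite scaler0 addr0.
- by exists 0; rewrite scale0r subr0.
- move=> a x y [r xr] [s ys]; exists (a * r + s).
  rewrite scalerDl -scalerA opprD addrACA -scalerBr; exact: IHl.
Qed.

Lemma span_mem M (l : seq M) x : x \in l -> span l x.
Proof.
elim: l => //= g l IH; rewrite inE => /orP[/eqP ->|/IH lx].
  by exists 1; rewrite scale1r subrr; apply: submod0 (submod_span l).
by exists 0; rewrite scale0r subr0.
Qed.

Lemma span_sub M (l : seq M) (S : M -> Prop) : submod S ->
  (forall x, x \in l -> S x) -> forall x, span l x -> S x.
Proof.
move=> SS; elim: l => [|g l IH] lS x /=; first by move->; apply: submod0.
move=> [r /IH]; rewrite -[in S x](subrK (r *: g) x) => Sx.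
apply: submodD => //.
  by apply: Sx => y yl; apply: lS; rewrite inE yl orbT.
by apply: submodZ => //; apply: lS; rewrite mem_head.
Qed.

Lemma span_cat M (l1 l2 : seq M) x y :
  span l1 x -> span l2 y -> span (l1 ++ l2) (x + y).
Proof.
move=> xl yl; apply: submodD; first exact: submod_span.
  apply: span_sub xl; first exact: submod_span.
  by move=> z zl; apply: span_mem; rewrite mem_cat zl.
apply: span_sub yl; first exact: submod_span.
by move=> z zl; apply: span_mem; rewrite mem_cat zl orbT.
Qed.

Lemma span_fam M n (g : 'I_n -> M) x :
  span [seq g i | i <- enum 'I_n] x <-> exists c : 'I_n -> R, x = \sum_i c i *: g i.
Proof.
split=> [|[c ->]]; last first.
  apply: submod_sum => [|i _]; first exact: submod_span.
  by apply: submodZ; [apply: submod_span | apply/span_mem/map_f; rewrite mem_enum].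
apply: (span_sub (S := fun x => exists c, x = \sum_i c i *: g i)) => [|_ /mapP[i _ ->]].
  split=> [|a _ _ [c ->] [d ->]].
    by exists (fun=> 0); rewrite big1 // => i _; rewrite scale0r.
  exists (fun i => a * c i + d i); rewrite scaler_sumr -big_split.
  by apply: eq_bigr => i _; rewrite scalerDl scalerA.
exists (fun j => (j == i)%:R); rewrite (bigD1 i) //= eqxx scale1r big1 ?addr0 //.
by move=> j /negPf ->; rewrite scale0r.
Qed.

Definition fgs M (S : M -> Prop) := exists l : seq M, forall x, S x <-> span l x.

Lemma fg_span M : finitely_generated M <-> exists l : seq M, forall x, span l x.
Proof.
split=> [[n [g gM]]|[l lM]].
  by exists [seq g i | i <- enum 'I_n] => x; apply/span_fam.
exists (size l), (tnth (in_tuple l)) => x; apply/span_fam.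
suff -> : [seq tnth (in_tuple l) i | i <- enum 'I_(size l)] = l by [].
exact: map_tnth_enum.
Qed.

Lemma fg_cover M : finitely_generated M <->
  exists s (T : {linear 'rV[R]_s -> M}), surjective T.
Proof.
split=> [[n [g gM]]|[s [T TS]]].
  have [T TE] := rV_linear_of g; exists n, T => x.
  have [c ->] := gM x; exists (\row_i c i); rewrite TE.
  by apply: eq_bigr => i _; rewrite mxE.
exists s, (fun i => T (delta_mx 0 i)) => x; have [v <-] := TS x.
by exists (fun i => v 0 i); apply: linear_rV.
Qed.

Lemma fg_surj M N (p : {linear M -> N}) :
  surjective p -> finitely_generated M -> finitely_generated N.
Proof.
move=> pS /fg_cover[s [T TS]]; apply/fg_cover; exists s, (p \o T) => y.
by have [x <-] := pS y; have [v <-] := TS x; exists v.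
Qed.

Lemma fg_rV s : finitely_generated 'rV[R]_s.
Proof. by apply/fg_cover; exists s, idfun => x; exists x. Qed.

Lemma fg_regular : finitely_generated R^o.
Proof. by exists 1%N, (fun=> 1) => x; exists (fun=> x); rewrite big_ord1 [_ *: _]mulr1. Qed.

Lemma fgs_ext M N (e : {linear M -> N}) (S : M -> Prop) : submod S ->
  fgs (fun y => exists2 x, S x & e x = y) -> fgs (fun x => S x /\ e x = 0) -> fgs S.
Proof.
move=> SS [l lE] [k kE].
have [t tS tE] : exists2 t : seq M, (forall x, x \in t -> S x) & map e t = l.
  have: forall y, y \in l -> exists2 x, S x & e x = y.
    by move=> y yl; apply/lE/span_mem.
  elim: l {lE} => [|y l IH] lS; first by exists [::].
  have [x Sx xy] := lS y (mem_head _ _).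
  have [z zl|t tS tl] := IH; first by apply: lS; rewrite inE zl orbT.
  exists (x :: t) => /=; last by rewrite xy tl.
  by move=> z; rewrite inE => /orP[/eqP ->|/tS].
exists (t ++ k) => x; split=> [Sx|]; last first.
  apply: span_sub => // z; rewrite mem_cat => /orP[/tS//|/span_mem/kE[]//].
have [y yt yx] : exists2 y, span t y & e y = e x.
  have : span l (e x) by apply/lE; exists x.
  rewrite -tE; elim: (t) (e x) => [|g t' IH] w /=.
    by move->; exists 0; rewrite ?linear0.
  move=> [r /IH[y yt' ye]]; exists (y + r *: g).
    by exists r; rewrite addrK.
  by rewrite linearD linearZZ ye subrK.
rewrite -(subrK y x) addrC; apply: span_cat => //; apply/kE.
split; last by rewrite linearB yx subrr.
by apply: submodB => //; apply: span_sub yt.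
Qed.

End Span.

Section Noetherian.
Variable R : comNzRingType.
Hypothesis noethR : noetherian R.
Implicit Types A B C M N L : lmodType R.

Lemma fgs_ideal (I : R^o -> Prop) : submod I -> fgs I.
Proof.
move=> IS; have [|n [g gE]] := noethR (I := (fun x => `[< I x >]) : {pred R^o}).
  split=> [|a x y /asboolP Ix /asboolP Iy]; apply/asboolP; first exact: submod0.
  by apply: (IS.2).
exists [seq (g i : R^o) | i <- enum 'I_n] => x; split=> [Ix|/span_fam[c ->]].
  by apply/span_fam/gE/asboolP.
by have /gE/asboolP : exists d : 'I_n -> R, \sum_i c i *: (g i : R^o) = \sum_i d i * g i
  by exists c.
Qed.

Lemma fgs_sub M (l : seq M) (S : M -> Prop) : submod S ->
  (forall x, S x -> span l x) -> fgs S.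
Proof.
elim: l S => [|g l IH] S SS Sl.
  by exists [::] => x; split=> [/Sl//|/= ->]; apply: submod0.
(* [I] collects the coefficients at [g] of elements of [S]. Elements [t] of [S] over generators of
   this ideal reduce the claim to the part of [S] inside the span of [l], generated by [k]. *)
pose I (r : R^o) := exists2 y, span l y & S (y + r *: g).
have IS : submod I.
  split=> [|a r s [y yl Sy] [z zl Sz]].
    exists 0; first exact: submod0 (submod_span l).
    by rewrite scale0r addr0; apply: submod0.
  exists (a *: y + z); first exact: (submod_span l).2.
  by rewrite scalerDl -scalerA addrACA -scalerDr; apply: (SS.2).
have [rl rlE] := fgs_ideal IS.
have [k kE] : fgs (fun x => S x /\ span l x).
  apply: IH => [|x []//]; split.
    by split; apply: submod0 => //; apply: submod_span.
  move=> a x y [Sx lx] [Sy ly]; split; first exact: (SS.2).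
  exact: (submod_span l).2.
have [t [tS tE]] : exists t : seq M, (forall x, x \in t -> S x) /\
    forall r, span rl r -> exists2 x, span t x & span l (x - r *: g).
  have: forall r, r \in rl -> I r by move=> r /span_mem/rlE.
  elim: rl {rlE} => [|r rl IHr] rI.
    exists [::]; split=> // _ ->; exists 0 => //=.
    by rewrite scale0r subr0; apply: submod0 (submod_span l).
  have [s srl|t [tS tE]] := IHr; first by apply: rI; rewrite inE srl orbT.
  have [y yl Sy] := rI r (mem_head _ _).
  exists (y + r *: g :: t); split.
    by move=> z; rewrite inE => /orP[/eqP ->|/tS].
  move=> s /= [a /tE[x xt xl]]; exists (x + a *: (y + r *: g)).
    by exists a; rewrite addrK.
  have -> : x + a *: (y + r *: g) - s *: g = (x - (s - a *: r) *: g) + a *: y.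
    rewrite scalerBl -scalerA scalerDr opprB -!addrA; congr (x + _).
    by rewrite addrC -addrA.
  apply: submodD => //; first exact: submod_span.
  by apply: submodZ => //; apply: submod_span.
exists (t ++ k) => x; split=> [Sx|]; last first.
  by apply: span_sub => // z; rewrite mem_cat => /orP[/tS//|/span_mem/kE[]].
have [r rx] := Sl x Sx.
have Ir : I r by exists (x - r *: g); rewrite ?subrK.
have [y yt yl] := tE r (proj1 (rlE r) Ir).
rewrite -(subrK y x) addrC; apply: span_cat => //; apply/kE.
split; first by apply: submodB => //; apply: span_sub yt.
have -> : x - y = (x - r *: g) - (y - r *: g) by rewrite opprB addrA subrK.
by apply: submodB => //; apply: submod_span.
Qed.

Lemma fg_fgs M (S : M -> Prop) : finitely_generated M -> submod S -> fgs S.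
Proof. by move=> /fg_span[l lM] SS; apply: (@fgs_sub M l). Qed.

Lemma fg_inj M N (i : {linear N -> M}) :
  injective i -> finitely_generated M -> finitely_generated N.
Proof.
move=> iI /fg_fgs/(_ (submod_img i))[l lE].
have [t tE] : exists t : seq N, map i t = l.
  have: forall y, y \in l -> exists x, i x = y by move=> y /span_mem/lE.
  elim: l {lE} => [|y l IH] lS; first by exists [::].
  have [x <-] := lS y (mem_head _ _).
  have [z zl|t <-] := IH; first by apply: lS; rewrite inE zl orbT.
  by exists (x :: t).
apply/fg_span; exists t => x; have : span l (i x) by apply/lE; exists x.
rewrite -tE; elim: (t) (x) => [|g t' IH] w /=.
  by move=> /(injective_eq0 iI).
by move=> [r]; rewrite -linearZZ -linearB => /IH; exists r.
Qed.

Lemma fg_ses A B C (i : {linear A -> B}) (p : {linear B -> C}) : ses i p ->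
  finitely_generated A -> finitely_generated C -> finitely_generated B.
Proof.
move=> [iI pS ip] /fg_span[k kA] /fg_fgs Cfg.
suff [l lE] : fgs (fun _ : B => True) by apply/fg_span; exists l => x; apply/lE.
apply: (@fgs_ext _ _ _ p) => //.
  apply: Cfg; split=> [|a x y _ _]; first by exists 0; rewrite ?linear0.
  by have [z <-] := pS (a *: x + y); exists z.
exists (map i k) => x; split.
  move=> [_ /ip[a <-]]; elim: (k) (a) (kA a) => [|g t IH] w /=.
    by move->; rewrite linear0.
  by move=> [r /IH]; rewrite linearB linearZZ; exists r.
apply: (span_sub (S := fun x => True /\ p x = 0)) => [|_ /mapP[a _ ->]];
  last by split=> //; apply/ip; exists a.
have [K0 KS] := submod_ker p.
by split=> [//|a y z [_ py] [_ pz]]; split=> //; apply: KS.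
Qed.

Lemma fg_hom M N : finitely_generated M -> finitely_generated N ->
  finitely_generated {linear M -> N}.
Proof.
move=> /fg_span[l lM] Nfg.
(* The claim is generalised to submodules whose elements are determined by their values on [l]:
   evaluation at one generator has finitely generated image in [N], and its kernel is determined by
   the remaining generators. *)
suff H (S : {linear M -> N} -> Prop) : submod S ->
    (forall f, S f -> (forall x, x \in l -> f x = 0) -> f = 0) -> fgs S.
  have [|f _ f0|k kE] := H (fun=> True); first by [].
    apply: linear_ext => x; apply: (span_sub (submod_ker f) _ (lM x)).
    by move=> y /f0.
  by apply/fg_span; exists k => f; apply/kE.
elim: l S {lM} => [|g l IH] S SS S0.
  exists [::] => f; split=> [Sf|/= ->]; last exact: submod0.
  exact: S0.
have [|ev evE] := @linear_of _ {linear M -> N} N (fun f => f g); first by [].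
apply: (@fgs_ext _ _ _ ev) => //.
  apply: fg_fgs => //; split; first by exists 0; rewrite ?linear0 //; apply: submod0.
  move=> a _ _ [f Sf <-] [h Sh <-]; exists (a *: f + h); last by rewrite linearP.
  exact: (SS.2).
apply: IH => [|f [Sf]].
  have [K0 KS] := submod_ker ev.
  split=> [|a f h [Sf kf] [Sh kh]]; first by split=> //; apply: submod0.
  by split; [apply: (SS.2) | apply: KS].
rewrite evE => fg0 fl; apply: S0 => // x.
by rewrite inE => /orP[/eqP ->|/fl].
Qed.

Lemma acc M (T : nat -> M -> Prop) : finitely_generated M ->
  (forall n, submod (T n)) -> (forall n x, T n x -> T n.+1 x) ->
  exists n0, forall n x, T n x -> T n0 x.
Proof.
move=> Mfg TS Tinc.
have Tle m n x : (m <= n)%N -> T m x -> T n x.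
  by move=> /subnK <-; elim: (n - m)%N => // k IH /IH; apply: Tinc.
have [|l lE] := @fg_fgs M (fun x => exists n, T n x) Mfg.
  split=> [|a x y [m Tx] [n Ty]]; first by exists 0%N; apply: submod0.
  exists (maxn m n); apply: (TS _).2.
    by apply: Tle Tx; apply: leq_maxl.
  by apply: Tle Ty; apply: leq_maxr.
have [n0 n0E] : exists n0, forall x, x \in l -> T n0 x.
  have: forall x, x \in l -> exists n, T n x by move=> x /span_mem/lE.
  elim: l {lE} => [|x l IH] lT; first by exists 0%N.
  have [m Tx] := lT x (mem_head _ _).
  have [y yl|n nT] := IH; first by apply: lT; rewrite inE yl orbT.
  exists (maxn m n) => y; rewrite inE => /orP[/eqP ->|/nT].
    by apply: Tle Tx; apply: leq_maxl.
  by apply: Tle; apply: leq_maxr.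
exists n0 => n x Tx; apply: (span_sub (TS n0) n0E).
by apply/lE; exists n.
Qed.

(** Every counterexample would have a strictly larger one above it, against the ascending chain
    condition [acc]. *)
Lemma ideal_ind (P : (R^o -> Prop) -> Prop) :
  (forall I, submod I -> (forall J, submod J -> (forall x, I x -> J x) ->
     (exists2 x, J x & ~ I x) -> P J) -> P I) ->
  forall I, submod I -> P I.
Proof.
move=> step I IS; apply: contrapT => nP.
pose bad := {J : R^o -> Prop | submod J /\ ~ P J}.
have next (J : bad) : exists K : bad,
    (forall x, sval J x -> sval K x) /\ exists2 x, sval K x & ~ sval J x.
  case: J => J [JS nPJ] /=; apply: contrapT => nK; apply/nPJ/step => // K KS JK KJ.
  by apply: contrapT => nPK; apply: nK; exists (exist _ K (conj KS nPK)).
have [nx nxP] := choice next.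
pose T n := sval (iter n nx (exist _ I (conj IS nP))).
have [|n x|n0 n0E] := @acc R^o T (fg_regular R).
- by move=> n; rewrite /T; case: (iter _ _ _) => J [].
- by move=> Tx; apply: (nxP _).1.
- have [x Tx] := (nxP (iter n0 nx (exist _ I (conj IS nP)))).2; apply.
  exact: (n0E n0.+1).
Qed.

End Noetherian.

(** * Totally reflexive modules *)

Section Resolutions.
Variable R : comNzRingType.
Implicit Types A B C M N L : lmodType R.

Lemma ses_ker M N (p : {linear M -> N}) : surjective p ->
  exists (K : lmodType R) (i : {linear K -> M}), ses i p.
Proof.
move=> pS; have [K [i [iI iE]]] := submodule_exists (submod_ker p).
by exists K, i; split=> // y; apply: iE.
Qed.

Lemma resolution_shift M (P : nat -> lmodType R)
    (d : forall i, {linear P i.+1 -> P i}) (e : {linear P 0%N -> M}) :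
  projective_resolution d e ->
  exists (K : lmodType R) (i : {linear K -> P 0%N}) (d' : {linear P 1%N -> K}),
  [/\ ses i e, surjective d', forall x, i (d' x) = d 0%N x & exact_at (d 1%N) d'].
Proof.
move=> [Pp eS e0 dE]; have [K [i ie]] := ses_ker eS; have [iI _ iE] := ie.
have [|d' d'E] := @lift_inj _ K (P 0%N) (P 1%N) i (d 0%N) iI.
  by move=> x; apply/iE/e0; exists x.
exists K, i, d'; split=> // [k|x].
  have /e0[x xE] : e (i k) = 0 by apply/iE; exists k.
  by exists x; apply: iI; rewrite d'E.
split=> [d'x|/dE dx]; first by apply/dE; rewrite -d'E d'x linear0.
by apply: iI; rewrite d'E dx linear0.
Qed.

(** This is the balance of Ext, obtained by shifting dimension on both sides at once; it also makes
    [Ext_eq0] with values in R independent of the resolution. *)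
Lemma van_resolution j M (P : nat -> lmodType R)
    (d : forall i, {linear P i.+1 -> P i}) (e : {linear P 0%N -> M}) :
  projective_resolution d e ->
  van j M <-> forall phi : {linear P j.+1 -> R^o}, (forall x, phi (d j.+1 x) = 0) ->
        exists psi : {linear P j -> R^o}, forall x, phi x = psi (d j x).
Proof.
elim: j M P d e => [|j IH] M P d e res.
  have [K [i [d' [ie d'S d'E d'0]]]] := resolution_shift res.
  have [Pp _ _ _] := res.
  split=> [Mv phi phi0|H].
    have [|f fE] := descend (f := phi) d'S; first by move=> x /d'0[y <-].
    have [g gE] := van_extends ie Mv f.
    by exists g => x; rewrite -d'E gE fE.
  apply: (extends_van ie); first exact: van_projective.
  move=> f; have [x|g gE] := H (f \o d').
    by rewrite /= (_ : d' _ = 0) ?linear0 //; apply/d'0; exists x.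
  by exists g => k; have [x <-] := d'S k; rewrite d'E -gE.
have [K [i [d' [ie d'S d'E d'0]]]] := resolution_shift res.
have [Pp _ _ dE] := res.
have resK : @projective_resolution _ K (fun n => P n.+1) (fun n => d n.+1) d'.
  by split.
rewrite -(IH _ _ _ _ resK); split=> [Mv|Kv].
  exact: (van_left ie Mv (van_projective (Pp 0%N))).
exact: (van_right ie Kv (van_projective (Pp 0%N))).
Qed.

Hypothesis noethR : noetherian R.

Record fcover M := FCover {
  fc_rank : nat;
  fc_map : {linear 'rV[R]_fc_rank -> M};
  fc_ker : lmodType R;
  fc_incl : {linear fc_ker -> 'rV[R]_fc_rank};
  fc_ses : ses fc_incl fc_map;
  fc_fg : finitely_generated fc_ker }.

Lemma fcover_exists M : finitely_generated M -> exists c : fcover M, True.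
Proof.
move=> /fg_cover[s [T /ses_ker[K [i iT]]]].
have Kfg : finitely_generated K by case: iT => /fg_inj iI _ _; apply: iI (fg_rV _ _).
by exists (FCover iT Kfg).
Qed.

Lemma free_resolution M : finitely_generated M ->
  exists (P : nat -> lmodType R) (d : forall i, {linear P i.+1 -> P i})
         (e : {linear P 0%N -> M}), projective_resolution d e.
Proof.
move=> Mfg; pose cov (Z : {M : lmodType R | finitely_generated M}) : fcover (sval Z) :=
  projT1 (cid (fcover_exists (svalP Z))).
pose Z n := iter n (fun Z => exist _ (fc_ker (cov Z)) (fc_fg (cov Z)))
  (exist _ M Mfg : {M : lmodType R | finitely_generated M}).
pose P n : lmodType R := 'rV[R]_(fc_rank (cov (Z n))).
pose T n : {linear P n -> sval (Z n)} := fc_map (cov (Z n)).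
pose I n : {linear sval (Z n.+1) -> P n} := fc_incl (cov (Z n)).
have IT n : ses (I n) (T n) := fc_ses (cov (Z n)).
have exI n y : T n y = 0 <-> exists x, (I n \o T n.+1) x = y.
  have [_ _ E] := IT n; have [_ S _] := IT n.+1.
  split=> [/E[x <-]|[x <-]]; last by apply/E; exists (T n.+1 x).
  by have [v <-] := S x; exists v.
exists P, (fun n => I n \o T n.+1), (T 0%N); split.
- by move=> n; apply: projective_rV.
- by have [_ S _] := IT 0%N.
- exact: (exI 0%N).
- move=> n y; rewrite -(exI n.+1) /=; have [iI _ _] := IT n.
  by split=> [|->]; [apply: (injective_eq0 iI) | rewrite linear0].
Qed.

Lemma Ext_van j M : finitely_generated M -> Ext_eq0 j.+1 M R^o <-> van j M.
Proof.
move=> /free_resolution[P [d [e res]]].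
split=> [[P' [d' [e' [res' H]]]]|Mv]; first exact/(van_resolution j res').
by exists P, d, e; split=> //; apply/(van_resolution j res).
Qed.

Definition reflexive_mod M :=
  (forall x : M, (forall f : {linear M -> R^o}, f x = 0) -> x = 0) /\
  forall th : {linear dual M -> R^o}, exists x : M,
    forall f : {linear M -> R^o}, th f = f x.

Lemma reflexiveP M : bijective (@biduality R M) <-> reflexive_mod M.
Proof.
split=> [[g gK Kg]|[M0 MS]].
  split=> [x fx|th]; last first.
    by exists (g th) => f; rewrite -[in LHS](Kg th).
  have [|h hE] := @linear_of _ M (dual (dual M)) (@biduality R M).
    by move=> a u v; apply: linear_ext => f /=; rewrite /evaluation linearP.
  have h0 : h 0 = h x.
    by rewrite linear0 hE; apply: linear_ext => f /=; rewrite /evaluation fx.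
  by rewrite -(gK x) -hE -h0 hE gK.
have /choice[g gE] := MS.
exists g => [x|th].
  apply/subr0_eq/M0 => f; rewrite linearB -(gE (biduality x)).
  by rewrite /= /evaluation subrr.
by apply: linear_ext => f; rewrite /= /evaluation -gE.
Qed.

(** [van n] concerns degree n + 1, so all [n] together cover exactly the positive degrees. *)
Record TR M : Prop := TRmk {
  TR_fg : finitely_generated M;
  TR_refl : reflexive_mod M;
  TR_van : forall n, van n M;
  TR_dual : forall n, van n (dual M) }.

Lemma totally_reflexiveP M : totally_reflexive M <-> TR M.
Proof.
split=> [[Mfg /reflexiveP Mr Mv Md]|[Mfg Mr Mv Md]].
  have dfg : finitely_generated (dual M) by apply: fg_hom => //; apply: fg_regular.
  by split=> // n; apply/Ext_van => //; [apply: Mv | apply: Md].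
have dfg : finitely_generated (dual M) by apply: fg_hom => //; apply: fg_regular.
by split; [|apply/reflexiveP|move=> [|i] // _; apply/Ext_van..].
Qed.

Lemma precomp_exists M N L (f : {linear M -> N}) :
  exists F : {linear {linear N -> L} -> {linear M -> L}},
    forall g x, F g x = g (f x).
Proof.
have [|F FE] := @linear_of _ {linear N -> L} {linear M -> L} (fun g => g \o f).
  by move=> a g h; apply: linear_ext.
by exists F => g x; rewrite FE.
Qed.

Lemma TR_retract M L (i : {linear M -> L}) (p : {linear L -> M}) :
  (forall x, p (i x) = x) -> TR L -> TR M.
Proof.
move=> ip [Lfg [L0 LS] Lv Ld].
have [Fp FpE] := precomp_exists R^o p; have [Fi FiE] := precomp_exists R^o i.
split.
- by apply: (fg_surj (p := p)) Lfg => x; exists (i x).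
- split=> [x fx|th].
    by rewrite -(ip x) (L0 (i x)) ?linear0 // => f; apply: (fx (f \o i)).
  have [y yE] := LS (th \o Fi); exists (p y) => f.
  have := yE (f \o p) => /= <-; congr (th _); apply: linear_ext => x.
  by rewrite FiE /= ip.
- by move=> n; apply: van_retract (Lv n).
- move=> n; apply: (van_retract (i := Fp) (p := Fi)) (Ld n) => f.
  by apply: linear_ext => x; rewrite FiE FpE ip.
Qed.

(** Dualizing keeps the sequence exact because Ext^1(C, R) = 0, so the vanishing of Ext passes to
    the dual of [B]; reflexivity is the five lemma carried out on elements. *)
Lemma TR_ses A B C (i : {linear A -> B}) (p : {linear B -> C}) :
  ses i p -> TR A -> TR C -> TR B.
Proof.
move=> ip [Afg [A0 AS] Av Ad] [Cfg [C0 CS] Cv Cd]; have [iI pS E] := ip.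
have ext (f : {linear A -> R^o}) : exists g : {linear B -> R^o}, forall x, g (i x) = f x.
  exact: (van_extends ip (Cv 0%N) f).
have [Fp FpE] := precomp_exists R^o p; have [Fi FiE] := precomp_exists R^o i.
have FpI : injective Fp.
  move=> f g fg; apply: linear_ext => y; have [x <-] := pS y.
  by rewrite -!FpE fg.
have FiS : surjective Fi.
  by move=> f; have [g gE] := ext f; exists g; apply: linear_ext => x; rewrite FiE.
have FE : exact_at Fp Fi.
  move=> f; split=> [f0|[g <-]]; last first.
    apply: linear_ext => x; rewrite FiE FpE (_ : p _ = 0) ?linear0 //.
    by apply/E; exists x.
  have [|g gE] := ses_descend ip (f := f).
    by move=> x; have := FiE f x; rewrite f0.
  by exists g; apply: linear_ext => x; rewrite FpE gE.
have Fip : ses Fp Fi by [].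
split.
- exact: (fg_ses noethR ip).
- split=> [x fx|th].
    have /E[a aE] : p x = 0 by apply: C0 => f; rewrite -FpE.
    rewrite -aE (A0 a) ?linear0 // => f; have [g gE] := ext f.
    by rewrite -gE aE.
  have [c cE] := CS (th \o Fp); have [b bE] := pS c.
  have [|ev evE] := @linear_of _ (dual B) R^o (fun f => (f : {linear B -> R^o}) b).
    by [].
  have [|h hE] := ses_descend Fip (f := th \- ev).
    move=> f /=; apply/eqP; rewrite subr_eq0; apply/eqP.
    by have := cE f => /= ->; rewrite evE FpE bE.
  have [a aE] := AS h; exists (i a + b) => f.
  have := hE f; rewrite aE FiE /= evE => faE.
  by rewrite linearD faE subrK.
- by move=> n; apply: (van_mid ip).
- by move=> n; apply: (van_mid Fip).
Qed.

Lemma TR_rV s : TR 'rV[R]_s.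
Proof.
have cE i : exists f : {linear 'rV[R]_s -> R^o}, forall v, f v = v 0 i.
  by apply: linear_of => a u v; rewrite !mxE.
split.
- exact: fg_rV.
- split=> [x fx|th].
    by apply/rowP => i; have [f fE] := cE i; rewrite -fE fx mxE.
  have /choice[c {}cE] := cE; exists (\row_i th (c i)) => f.
  have fE : \sum_i f (delta_mx 0 i) *: (c i : dual 'rV[R]_s) = f.
    apply: linear_ext => v; rewrite (linear_rV f v).
    by rewrite [LHS]linear_sumE; apply: eq_bigr => i _ /=; rewrite cE [_ *: _]mulrC.
  rewrite (linear_rV f) -[in LHS]fE linear_sum; apply: eq_bigr => i _.
  by rewrite linearZZ mxE /= [_ *: _]mulrC.
- by move=> n; apply: van_rV.
- by move=> n; apply: van_dual_rV.
Qed.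

Lemma TR_syzygy s (K M : lmodType R)
    (i : {linear K -> 'rV[R]_s}) (T : {linear 'rV[R]_s -> M}) :
  ses i T -> TR M -> TR K.
Proof.
move=> iT [Mfg [M0 MS] Mv Md]; have [iI TS E] := iT.
have [Ffg [F0 FS] Fv Fd] := TR_rV s.
have ext (f : {linear K -> R^o}) :
    exists g : {linear 'rV[R]_s -> R^o}, forall x, g (i x) = f x.
  exact: (van_extends iT (Mv 0%N) f).
have [FT FTE] := precomp_exists R^o T; have [Fi FiE] := precomp_exists R^o i.
have FTI : injective FT.
  move=> f g fg; apply: linear_ext => y; have [x <-] := TS y.
  by rewrite -!FTE fg.
have FiS : surjective Fi.
  by move=> f; have [g gE] := ext f; exists g; apply: linear_ext => x; rewrite FiE.
have Fi0 f : Fi (FT f) = 0.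
  apply: linear_ext => x; rewrite FiE FTE (_ : T _ = 0) ?linear0 //.
  by apply/E; exists x.
have FE : exact_at FT Fi.
  move=> f; split=> [f0|[g <-]]; last exact: Fi0.
  have [|g gE] := ses_descend iT (f := f).
    by move=> x; have := FiE f x; rewrite f0.
  by exists g; apply: linear_ext => x; rewrite FTE gE.
have Fip : ses FT Fi by [].
split.
- exact: (fg_inj noethR iI).
- split=> [x fx|th].
    by apply: (injective_eq0 iI); apply: F0 => f; apply: (fx (f \o i)).
  have [v vE] := FS (th \o Fi).
  have /E[x xE] : T v = 0.
    by apply: M0 => f; rewrite -FTE -vE /= Fi0 linear0.
  exists x => f; have [g gE] := ext f.
  by rewrite -gE xE -vE /=; congr (th _); apply: linear_ext => y; rewrite FiE gE.
- by move=> n; apply: (van_left iT (Mv n.+1) (Fv n)).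
(* The lowest degree is beyond dimension shifting: Ext^1 of the dual of [K] vanishes once
   functionals on the dual of [M] extend to the dual of the free module. By reflexivity they are
   evaluations at elements of [M], and these lift along [T]. *)
- case=> [|n]; last exact: (van_right Fip (Md n) (Fd n.+1)).
  apply: (extends_van Fip (Fd 0%N)) => th; have [m mE] := MS th.
  have [v vE] := TS m.
  have [|ev evE] := @linear_of _ (dual 'rV[R]_s) R^o
      (fun f => (f : {linear 'rV[R]_s -> R^o}) v).
    by [].
  by exists ev => f; rewrite evE FTE vE mE.
Qed.

Lemma ses_pair M N :
  exists (i : {linear M -> (M * N)%type}) (p : {linear (M * N)%type -> N}),
  ses i p /\ (forall x, i x = (x, 0)) /\ (forall z, p z = z.2).
Proof.
have [|i iE] := @linear_of _ M (M * N)%type (fun x => (x, 0)).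
  by move=> a x y; rewrite pairZ pairD scaler0 addr0.
have [|p pE] := @linear_of _ (M * N)%type N (fun z => z.2) => //.
exists i, p; split=> //; split.
- by move=> x y; rewrite !iE => -[].
- by move=> y; exists (0, y); rewrite pE.
- move=> [x y]; rewrite pE /=; split=> [->|[z]]; first by exists x; rewrite iE.
  by rewrite iE => -[].
Qed.

Lemma TR_prod M N : TR M -> TR N -> TR (M * N)%type.
Proof. by move=> MT NT; have [i [p [ip _]]] := ses_pair M N; apply: TR_ses ip MT NT. Qed.

End Resolutions.

(** * The residue field *)

Section ResidueField.
Variables (R : comNzRingType) (m : {pred R}).
Hypotheses (mI : idealr_closed m) (mU : forall x, x \notin m -> exists y, x * y = 1).

HB.instance Definition _ := isIdealr.Build R m mI.

Definition residue := Quotient.quot m.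
HB.instance Definition _ := GRing.ComNzRing.on residue.

Definition residue_pi (x : R) : residue := \pi_residue%qT x.

Lemma residue_piP x y : residue_pi x = residue_pi y <-> x - y \in m.
Proof. by rewrite Quotient.idealrBE; split=> [xy|/eqP//]; apply/eqP. Qed.

Lemma residue_piK (x : residue) : residue_pi (repr x) = x.
Proof. exact: reprK. Qed.

Lemma residue_pi_zmod : zmod_morphism residue_pi.
Proof. by move=> x y; apply: (raddfB (\pi_residue%qT : {additive R -> residue})). Qed.

Lemma residue_pi_monoid : monoid_morphism residue_pi.
Proof. by split=> [|x y]; rewrite /residue_pi ?rmorph1 ?rmorphM. Qed.

HB.instance Definition _ := GRing.isZmodMorphism.Build R residue residue_pi residue_pi_zmod.
HB.instance Definition _ :=
  GRing.isMonoidMorphism.Build R residue residue_pi residue_pi_monoid.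

Lemma residue_inv_exists (x : residue) :
  exists y : residue, (x != 0 -> y * x = 1) /\ (x = 0 -> y = 0).
Proof.
have [->|x0] := eqVneq x 0; first by exists 0; split=> // /eqP.
have xm : repr x \notin m.
  apply: contra x0 => xm; rewrite -[x]residue_piK -(rmorph0 residue_pi).
  by apply/eqP/residue_piP; rewrite subr0.
have [y xy] := mU xm; exists (residue_pi y); split=> [_|xz]; last by rewrite xz eqxx in x0.
by rewrite -[x]residue_piK -rmorphM mulrC xy rmorph1.
Qed.

Definition residue_inv x := projT1 (cid (residue_inv_exists x)).

Lemma residue_mulVf x : x != 0 -> residue_inv x * x = 1.
Proof. exact: (projT2 (cid (residue_inv_exists x))).1. Qed.

Lemma residue_invr0 : residue_inv 0 = 0.
Proof. exact: (projT2 (cid (residue_inv_exists 0))).2. Qed.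

HB.instance Definition _ :=
  GRing.ComNzRing_isField.Build residue residue_mulVf residue_invr0.

Lemma residue_field_exists : exists (k : fieldType) (pi : {rmorphism R -> k}),
  surjective pi /\ forall x, pi x != 0 -> exists y, x * y = 1.
Proof.
exists (residue : fieldType), (residue_pi : {rmorphism R -> residue}).
split=> [x|x xN0]; first by exists (repr x); apply: residue_piK.
apply: mU; apply: contra xN0 => xm.
by apply/eqP; rewrite -(rmorph0 residue_pi); apply/residue_piP; rewrite subr0.
Qed.
End ResidueField.

(** Noetherian induction replaces Zorn's lemma: either a strictly larger proper ideal exists and the
    induction applies to it, or [I] is itself maximal. *)
Lemma proper_sub_maximal (R : comNzRingType) (I : R^o -> Prop) :
  noetherian R -> submod I -> ~ I 1 ->
  exists m : {pred R}, maximal_ideal m /\ forall x, I x -> x \in m.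
Proof.
move=> noethR; move: I; apply: ideal_ind => // I IS IH I1.
have Iid (J : R^o -> Prop) : submod J -> ~ J 1 ->
    idealr_closed (fun x : R => `[< J x >] : bool).
  move=> JS J1; split.
  - by apply/asboolP; apply: submod0 JS.
  - by apply/asboolP.
  - by move=> a x y /asboolP Jx /asboolP Jy; apply/asboolP; apply: (JS.2 a x y).
have [[J [JS IJ JI J1]]|nJ] := pselect (exists J, [/\ submod J,
   forall x, I x -> J x, exists2 x, J x & ~ I x & ~ J 1]).
  have [m [mm mJ]] := IH J JS IJ JI J1.
  by exists m; split=> // x /IJ/mJ.
exists (fun x : R => `[< I x >] : bool); split; last by move=> x Ix; apply/asboolP.
split; first exact: Iid.
move=> J [J0 J1 JS] IJ x Jx; apply/asboolP; apply: contrapT => nIx; apply: nJ.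
exists (fun x : R^o => x \in J); split.
- by split=> // a u v; apply: JS.
- by move=> u Iu; apply: IJ; apply/asboolP.
- by exists x.
- by apply/negP.
Qed.

Lemma local_residue_field (R : comNzRingType) : noetherian R -> local_ring R ->
  exists (k : fieldType) (pi : {rmorphism R -> k}),
  surjective pi /\ forall x, pi x != 0 -> exists y, x * y = 1.
Proof.
move=> noethR [m [[mI mmax] mU]]; apply: (residue_field_exists mI) => x xm.
have xS : @submod R R^o (fun z => exists y, x * y = z).
  split=> [|a _ _ [y <-] [z <-]]; first by exists 0; rewrite mulr0.
  by exists (a * y + z); rewrite mulrDr mulrCA.
apply: contrapT => x1.
have [m' [m'm xm']] := proper_sub_maximal noethR xS x1.
move: xm; rewrite -(mU _ m'm) xm' //.
by exists 1; rewrite mulr1.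
Qed.

Section Nakayama.
Variables (R : comNzRingType) (k : fieldType) (pi : {rmorphism R -> k}).
Hypothesis piU : forall x, pi x != 0 -> exists y, x * y = 1.
Implicit Types M N : lmodType R.

(** Generators are discarded one by one: writing [g] as x g' modulo [T], and g' through [g] in turn,
    puts (1 - x r) g in [T] plus the span of [l], and 1 - x r is a unit. *)
Lemma nakayama M (T : M -> Prop) x : finitely_generated M -> submod T ->
  pi x = 0 -> (forall h, exists h', T (h - x *: h')) -> forall h, T h.
Proof.
move=> /fg_span[l lM] TS x0 Tx.
have {lM} : forall h, exists2 t, T t & span l (h - t).
  by move=> h; exists 0; [apply: submod0 | rewrite subr0].
elim: l => [|g l IH] Tl h.
  by have [t Tt /= /subr0_eq ->] := Tl h.
apply: IH h => h.
have [g' Tg'] := Tx g; have [t Tt [r /= tl]] := Tl g'.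
have [u uE] : exists u, (1 - x * r) * u = 1.
  by apply: piU; rewrite rmorphB rmorphM x0 mul0r subr0 rmorph1 oner_eq0.
(* g - x g' and g' - t - r g lie in T and in the span of l respectively *)
have gT : exists2 t, T t & span l (g - t).
  exists (u *: ((g - x *: g') + x *: t)).
    by apply: submodZ => //; apply: submodD => //; apply: submodZ.
  have -> : g - u *: (g - x *: g' + x *: t) = (u * x) *: (g' - t - r *: g).
    have gE : g = u *: g - (u * x * r) *: g.
      by rewrite -scalerBl -mulrA -{1}[u]mulr1 -mulrBr mulrC uE scale1r.
    rewrite {1}gE scalerDr !scalerBr !scalerA opprD opprB [_ *: g' - _]addrC -!addrA.
    by rewrite [- _ + (- _ + _)]addrC !addrA -!addrA addNKr !addrA.
  by apply: submodZ => //; apply: submod_span.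
have [s Ts [a /= sl]] := Tl h; have [v Tv vl] := gT.
exists (s + a *: v); first by apply: submodD => //; apply: submodZ.
have -> : h - (s + a *: v) = (h - s - a *: g) + a *: (g - v).
  by rewrite scalerBr opprD !addrA subrK.
by apply: submodD => //; [apply: submod_span | apply: submodZ => //; apply: submod_span].
Qed.

(** In a cover with the fewest generators, a relation with a unit coefficient would express one
    generator through the others. *)
Lemma minimal_cover M : finitely_generated M ->
  exists s (T : {linear 'rV[R]_s -> M}), surjective T /\
    forall v, T v = 0 -> forall i, pi (v 0 i) = 0.
Proof.
move=> /fg_cover[s0 [T0 T0S]].
pose P s := `[< exists T : {linear 'rV[R]_s -> M}, surjective T >].
have [|s /asboolP[T TS] smin] := @ex_minnP P; first by exists s0; apply/asboolP; exists T0.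
exists s, T; split=> // v Tv i; apply/eqP/negP => /negP/piU[u vu].
case: s T TS smin v Tv i vu => [|s] T TS smin v Tv i vu; first by case: i vu.
suff /smin : P s by rewrite ltnn.
apply/asboolP; have [T' T'E] := rV_linear_of_delta (fun j : 'I_s => T (delta_mx 0 (lift i j))).
exists T'; have im0 := submod_img T'.
have key : exists w, T' w = T (delta_mx 0 i).
  have : T (delta_mx 0 i) = - u *: \sum_(j < s) v 0 (lift i j) *: T (delta_mx 0 (lift i j)).
    have := Tv; rewrite linear_rV (bigD1_ord i) //= => /eqP.
    rewrite addr_eq0 => /eqP viE.
    by rewrite -[LHS]scale1r -vu mulrC -scalerA viE scalerN scaleNr.
  move=> ->; apply: (submodZ im0); apply: (submod_sum im0) => j _.
  by apply: (submodZ im0); exists (delta_mx 0 j).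
move=> y; have [w <-] := TS y; rewrite linear_rV.
apply: (submod_sum im0) => j _; apply: (submodZ im0).
by have [l ->|->] := unliftP i j; [exists (delta_mx 0 l) | exact: key].
Qed.

End Nakayama.

(** * Vanishing of Ext along a chain of short exact sequences *)

Section Chain.
Variable R : comNzRingType.
Hypothesis noethR : noetherian R.
Variables (B X V : nat -> lmodType R).
Variables (i : forall n, {linear B n -> X n}) (p : forall n, {linear X n -> B n.+1})
  (v : forall n, {linear X n -> V n}).
Hypotheses (iI : forall n, injective (i n))
  (pvS : forall n b w, exists x, p n x = b /\ v n x = w)
  (ipv : forall n x, (p n x = 0 /\ v n x = 0) <-> exists b, i n b = x)
  (Xv : forall n, van n (X n)) (Bfg : finitely_generated (B 0%N)).

Let pi0 n b : p n (i n b) = 0.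
Proof. by have [_ /(_ (ex_intro _ b erefl))[]] := @ipv n (i n b). Qed.
Let vi0 n b : v n (i n b) = 0.
Proof. by have [_ /(_ (ex_intro _ b erefl))[]] := @ipv n (i n b). Qed.

Lemma chain_descend n (L : lmodType R) (f : {linear X n -> L}) :
  (forall b, f (i n b) = 0) ->
  exists (g : {linear B n.+1 -> L}) (h : {linear V n -> L}),
    forall x, f x = g (p n x) + h (v n x).
Proof.
move=> fi.
have [|pv pvE] := @linear_of _ (X n) (B n.+1 * V n)%type (fun x => (p n x, v n x)).
  by move=> a x y; rewrite !linearP.
have [|x|h hE] := descend (p := pv) (f := f).
- by move=> [b w]; have [x [<- <-]] := pvS b w; exists x; rewrite pvE.
- by rewrite pvE => -[px vx]; have [/(_ (conj px vx))[b <-] _] := @ipv n x.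
have [|g gE] := @linear_of _ (B n.+1) L (fun b => h (b, 0)).
  by move=> a x y; rewrite -linearP pairZ pairD scaler0 addr0.
have [|k kE] := @linear_of _ (V n) L (fun w => h (0, w)).
  by move=> a x y; rewrite -linearP pairZ pairD scaler0 addr0.
by exists g, k => x; rewrite gE kE -linearD pairD addr0 add0r -hE pvE.
Qed.

(* The connecting isomorphism Ext^n(B n, R) = Ext^(n+1)(B n.+1 * V n, R)
   followed by restriction to B n.+1, as a relation between cocycles. *)
Definition connect n (f : {linear B n -> Cz R n}) (g : {linear B n.+1 -> Cz R n.+1}) :=
  exists e : {linear X n -> Ez R n},
    (forall b, e (i n b) = jz R n (f b)) /\
    forall x, v n x = 0 -> qz R n (e x) = g (p n x).

(** The class of [f] is the image of [psi] under n connecting steps. This is a relation rather than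
    a map because each step depends on the choice of an [e]. *)
Fixpoint link n (psi : {linear B 0%N -> Cz R 0%N}) :
    {linear B n -> Cz R n} -> Prop :=
  match n return ({linear B n -> Cz R n} -> Prop) with
  | 0 => fun f => f = psi
  | n'.+1 => fun g => exists f, link psi f /\ connect f g
  end.

Lemma linkP n a psi psi' (f f' : {linear B n -> Cz R n}) :
  link psi f -> link psi' f' -> link (a *: psi + psi') (a *: f + f').
Proof.
elim: n psi psi' f f' => [|n IH] psi psi' g g' /=; first by move=> -> ->.
move=> [f [ff [e [ei eg]]]] [f' [ff' [e' [ei' eg']]]].
exists (a *: f + f'); split; first exact: IH.
exists (a *: e + e'); split=> [b|x vx] /=; first by rewrite ei ei' linearP.
by rewrite linearP eg ?eg'.
Qed.

Lemma link0 n : link 0 (0 : {linear B n -> Cz R n}).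
Proof.
elim: n => [//|n IH]; exists 0; split=> //; exists 0; split=> [b|x _] /=.
  by rewrite linear0.
by rewrite linear0.
Qed.

Lemma connect_surj n (g : {linear B n.+1 -> Cz R n.+1}) (h : {linear V n -> Cz R n.+1}) :
  exists (f : {linear B n -> Cz R n}) (e : {linear X n -> Ez R n}),
  (forall b, e (i n b) = jz R n (f b)) /\
  forall x, qz R n (e x) = g (p n x) + h (v n x).
Proof.
have [e eE] := Xv (n := n) ((g \o p n) \+ (h \o v n)).
have [|f fE] := @Cz_lift R n _ (e \o i n).
  by move=> b /=; rewrite eE /= pi0 vi0 !linear0 addr0.
by exists f, e; split=> // b; rewrite fE.
Qed.

Lemma link_surj n (f : {linear B n -> Cz R n}) : exists psi, link psi f.
Proof.
elim: n f => [|n IH] f; first by exists f.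
have [g [e [ei eE]]] := connect_surj f 0.
have [psi psiE] := IH g; exists psi, g; split=> //; exists e; split=> // x _.
by rewrite eE addr0.
Qed.

Lemma connect_extend n (f : {linear B n -> Cz R n}) (e : {linear X n -> Ez R n})
    (rho : {linear X n -> Cz R n}) :
  (forall b, rho (i n b) = f b) -> (forall b, e (i n b) = jz R n (f b)) ->
  exists (g : {linear B n.+1 -> Ez R n}) (h : {linear V n -> Ez R n}),
    forall x, qz R n (e x) = qz R n (g (p n x) + h (v n x)).
Proof.
move=> ri ei; have [|g [h ghE]] := @chain_descend n _ (e \- (jz R n \o rho)).
  by move=> b /=; rewrite ei ri subrr.
by exists g, h => x; rewrite -ghE /= linearB qjz subr0.
Qed.

(** The iterated connecting map is well defined: from 0 it reaches only trivial classes. For n > 0 a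
    trivial class is a map factoring through an injective module, and such a map extends along
    [i n]. *)
Lemma link0_extends n (f : {linear B n -> Cz R n}) : link 0 f ->
  exists rho : {linear X n -> Cz R n}, forall b, rho (i n b) = f b.
Proof.
elim: n f => [|n IH] f /=; first by move->; exists 0.
move=> [f' [/IH[rho rhoE] [e [ei ef]]]].
have [g [h ghE]] := connect_extend rhoE ei.
have [g' g'E] := Ez_ext g (@iI n.+1).
exists (qz R n \o g') => b /=; rewrite g'E.
have [x [<- vx]] := @pvS n b 0.
by rewrite -ef // ghE vx linear0 addr0.
Qed.

(* The classes in Ext^0(B 0, R) killed by the n-th iterated connecting map form
   an ascending chain of submodules of a noetherian module; where it is
   stationary, Ext^(n+1)(V n, R) has to vanish. *)
Lemma chain_van : exists n0, forall n, (n0 <= n)%N -> van n (V n).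
Proof.
pose T n (psi : {linear B 0%N -> R^o}) := link psi (0 : {linear B n -> Cz R n}).
have TS n : submod (T n).
  split=> [|a x y Tx Ty]; first exact: link0.
  by have := linkP a Tx Ty; rewrite scaler0 addr0.
have Tinc n psi : T n psi -> T n.+1 psi.
  move=> Tp; exists 0; split=> //; exists 0; split=> [b|x _] /=; first by rewrite linear0.
  by rewrite linear0.
have Tle n1 n2 psi : (n1 <= n2)%N -> T n1 psi -> T n2 psi.
  by move=> /subnK <-; elim: (n2 - n1)%N => // l IH /IH; apply: Tinc.
have [n0 n0E] := acc noethR (fg_hom noethR Bfg (fg_regular R)) TS Tinc.
exists n0 => n nn0 c.
(* The pair (0, c) comes from some [f], and [f] from some [psi]. Its component on [B n.+1] being 0,
   [psi] lies in [T n.+1], hence in [T n] by stationarity; so [f] extends to [X n] and [c] is a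
   coboundary. *)
have [f [e [ei eE]]] := connect_surj 0 c.
have [psi psif] := link_surj f.
have /n0E/(Tle _ _ _ nn0) Tpsi : T n.+1 psi.
  exists f; split=> //; exists e; split=> // x vx.
  by rewrite eE vx linear0 addr0.
have : link 0 f.
  by have := linkP (-1) Tpsi psif; rewrite scaler0 add0r scaleN1r addNr.
move=> /link0_extends[rho rhoE].
have [g [h ghE]] := connect_extend rhoE ei.
exists h => w; have [x [px <-]] := @pvS n 0 w.
by have := eE x; rewrite ghE px linear0 !add0r => ->.
Qed.

End Chain.

(** * Vanishing of Ext(k, R) and injective dimension *)

Section FiniteInjectiveDimension.
Variable R : comNzRingType.
Hypothesis noethR : noetherian R.
Variables (k : fieldType) (pi : {rmorphism R -> k}).
Hypothesis piU : forall x, pi x != 0 -> exists y, x * y = 1.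

(** Multiplication by [x] is surjective on Ext^(n+1)(M, R), expressed on cocycles. *)
Definition ext_divisible n (M : lmodType R) (x : R) :=
  forall f : {linear M -> Cz R n.+1}, exists (f' : {linear M -> Cz R n.+1})
    (e : {linear M -> Ez R n}), forall y, f y = x *: f' y + qz R n (e y).

Lemma ext_divisible_syzygy n s (K M : lmodType R) x
    (i : {linear K -> 'rV[R]_s}) (T : {linear 'rV[R]_s -> M}) :
  ses i T -> ext_divisible n M x -> forall psi : {linear K -> Cz R n},
  exists (psi' : {linear K -> Cz R n}) (rho : {linear 'rV[R]_s -> Cz R n}),
    forall y, psi y = x *: psi' y + rho (i y).
Proof.
move=> iT Mx psi; have [iI TS E] := iT.
have Ti0 y : T (i y) = 0 by apply/E; exists y.
have [u uE] := Ez_ext (jz R n \o psi) iI.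
have [|f fE] := ses_descend iT (f := qz R n \o u).
  by move=> y /=; rewrite uE /= qjz.
have [f' [e feE]] := Mx f.
have [u' u'E] := van_rV (f' \o T).
have [|psi' psi'E] := @Cz_lift R n K (u' \o i).
  by move=> y /=; rewrite u'E /= Ti0 linear0.
have [|rho rhoE] := @Cz_lift R n 'rV[R]_s ((u \- x \*: u') \- (e \o T)).
  move=> y /=; rewrite !linearB linearZZ u'E /= -[qz _ _ (u y)]/((qz R n \o u) y) -fE.
  by rewrite feE [x *: _ + _]addrC addrK subrr.
exists psi', rho => y; apply: (@jzI R n).
by rewrite linearD linearZZ psi'E rhoE /= uE Ti0 linear0 subr0 addrC subrK.
Qed.

(** Dimension shifting moves divisibility down to n = 0, where Ext^1(M, R) is Hom(K, R) modulo the
    maps that extend to the free module; Nakayama's lemma applies to this finitely generated Hom. *)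
Lemma van_nakayama n (M : lmodType R) x : finitely_generated M -> pi x = 0 ->
  ext_divisible n M x -> van n M.
Proof.
move=> Mfg x0; elim: n M Mfg => [|n IH] M Mfg Mx.
  all: have [[s T K i iT Kfg] _] := fcover_exists noethR Mfg.
  all: have key := ext_divisible_syzygy iT Mx.
  apply: (extends_van iT); first exact: van_rV.
  pose S (psi : {linear K -> R^o}) :=
    exists rho : {linear 'rV[R]_s -> R^o}, forall y, rho (i y) = psi y.
  have SS : submod S.
    split=> [|a psi psi' [r rE] [r' r'E]]; first by exists 0.
    by exists (a *: r + r') => y /=; rewrite rE r'E.
  apply: (nakayama piU (fg_hom noethR Kfg (fg_regular R)) SS x0) => psi.
  have [psi' [rho rhoE]] := key psi; exists psi', rho => y /=.
  by rewrite rhoE addrC addKr.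
apply: (van_right iT); last exact: van_rV.
apply: IH => // psi; have [psi' [rho rhoE]] := key psi.
have [e eE] := van_rV rho; exists psi', (e \o i) => y /=.
by rewrite eE rhoE.
Qed.

Variables (K : lmodType R) (q0 : {linear R^o -> K}).
Hypotheses (q0S : surjective q0) (q0E : forall x, q0 x = 0 <-> pi x = 0).

(* Noetherian induction on I with Q = R/I: for x in the maximal ideal but not in
   I, use 0 -> R/(I : x) -> R/I -> R/(I + x) -> 0. If (I : x) = I this makes x
   act surjectively on Ext(R/I, R), and Nakayama applies. *)
Lemma van_cyclic n0 : (forall n, (n0 <= n)%N -> van n K) ->
  forall I : R^o -> Prop, submod I ->
  forall (Q : lmodType R) (q : {linear R^o -> Q}), surjective q ->
  (forall x, q x = 0 <-> I x) -> forall n, (n0 <= n)%N -> van n Q.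
Proof.
move=> Kv; apply: ideal_ind => // I IS IH Q q qS qE n nn0.
have qZ r x : q (r * x) = r *: q x by rewrite -linearZZ.
have [I1|I1] := pselect (I 1).
  have Q0 (y : Q) : y = 0.
    by have [r <-] := qS y; rewrite -[r]mulr1 qZ (proj2 (qE 1) I1) scaler0.
  by move=> f; exists 0 => y; rewrite (Q0 y) !linear0.
(* If there is no such [x], the proper ideal [I] contains the maximal ideal and so equals it, and
   [Q] is isomorphic to the residue field [K]. *)
have [[x [x0 Ix]]|nx] := pselect (exists x, pi x = 0 /\ ~ I x); last first.
  have IE r : I r <-> pi r = 0.
    split=> [Ir|r0]; last by apply: contrapT => Ir; apply: nx; exists r.
    apply/eqP/negP => /negP/piU[u ru]; apply: I1.
    by rewrite -ru mulrC; apply: (submodZ IS u Ir).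
  have [|f fE] := descend (f := q0) qS; first by move=> r /qE/IE/q0E.
  have [|g gE] := descend (f := q) q0S; first by move=> r /q0E/IE/qE.
  apply: (van_retract (i := f) (p := g)) (Kv n nn0) => y.
  by have [r <-] := qS y; rewrite fE gE.
pose S (r : R^o) := exists s : R, I (r - s * x).
have SS : submod S.
  split=> [|a r r' [s Is] [s' Is']].
    by exists 0; rewrite mul0r subr0; apply: submod0 IS.
  exists (a * s + s').
  have -> : a *: r + r' - (a * s + s') * x = a *: (r - s * x : R^o) + (r' - s' * x).
    by rewrite scalerBr mulrDl opprD addrACA -mulrA.
  exact: IS.2.
have IsubS r : I r -> S r by exists 0; rewrite mul0r subr0.
have [QS [qs [qsS qsE]]] := quotient_exists SS.
have vS m : (n0 <= m)%N -> van m QS.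
  apply: (IH S) qsS qsE _ => //; exists x => //.
  by exists 1; rewrite mul1r subrr; apply: submod0 IS.
have [|p pE] := descend (f := qs) qS; first by move=> r /qE/IsubS/qsE.
have pS : surjective p.
  by move=> y; have [r <-] := qsS y; exists (q r); rewrite pE.
pose J (r : R^o) := I (r * x).
have JS : submod J.
  split=> [|a r r' Ir Ir']; rewrite /J; first by rewrite mul0r; apply: submod0 IS.
  by rewrite mulrDl -mulrA; apply: IS.2.
have IJ r : I r -> J r.
  by move=> Ir; rewrite /J mulrC; apply: (submodZ IS x Ir).
have ex_of (QJ : lmodType R) (qj : {linear R^o -> QJ}) : surjective qj ->
    (forall r, qj r = 0 <-> J r) ->
    exists i : {linear QJ -> Q}, ses i p /\ forall r, i (qj r) = q (r * x).
  move=> qjS qjE.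
  have [|l lE] := @linear_of _ R^o Q (fun r => q (r * x)).
    by move=> a r r'; rewrite -linearP mulrDl -mulrA.
  have [|i iE] := descend (f := l) qjS; first by move=> r /qjE Jr; rewrite lE; apply/qE.
  exists i; split=> [|r]; last by rewrite iE lE.
  split=> // [|y].
    apply: linear_inj => y; have [r <-] := qjS y.
    by rewrite iE lE => /qE Jr; apply/qjE.
  have [r <-] := qS y; rewrite pE qsE; split=> [[s Is]|[z]].
    exists (qj s); rewrite iE lE; apply/esym/subr0_eq.
    by rewrite -linearB; apply/qE.
  have [s <-] := qjS z; rewrite iE lE => /eqP; rewrite eq_sym -subr_eq0 -linearB.
  by move=> /eqP/qE Is; exists s.
have [[y Jy Iy]|JI] := pselect (exists2 y, J y & ~ I y).
  have [QJ [qj [qjS qjE]]] := quotient_exists JS.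
  have [i [ip _]] := ex_of _ _ qjS qjE.
  apply: (van_mid ip) (vS _ nn0); apply: (IH J) qjS qjE _ _ => //.
  by exists y.
have [|i [ip iE]] := ex_of Q q qS.
  move=> r; rewrite qE; split=> [/IJ//|Jr]; apply: contrapT => Ir.
  by apply: JI; exists r.
apply: (@van_nakayama n Q x) => //.
  by apply: (fg_surj qS); apply: fg_regular.
(* [i] is multiplication by [x] on [Q], so an extension [g] of [f] along it satisfies f = x g; the
   obstruction lies in Ext^(n+2)(QS, R) = 0. *)
move=> f; have [g gE] := van_extends ip (vS n.+1 (leqW nn0)) f.
exists g, 0 => y; rewrite linear0 addr0 -gE; have [r <-] := qS y.
by rewrite iE mulrC qZ linearZZ.
Qed.

Lemma cyclic_van_injective n :
  (forall (A Q : lmodType R) (i : {linear A -> R^o}) (q : {linear R^o -> Q}),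
     ses i q -> van n Q) -> injective_module (Cz R n).
Proof.
move=> Rv; apply: baer_injective => A i f iI.
have [Q [q [qS qE]]] := quotient_exists (submod_img i).
have iq : ses i q by split.
exact: (van_extends iq (Rv _ _ _ _ iq)).
Qed.

Lemma injective_finite_dim (M : lmodType R) :
  injective_module M -> finite_injective_dimension M.
Proof.
move=> MI; pose I n : lmodType R := if n is 0%N then M else 'rV[R]_0.
have I0 n (x : I n.+1) : x = 0 by apply/rowP => -[].
exists I, (idfun : {linear M -> M}), (fun n => 0 : {linear I n -> I n.+1}).
split; last by exists 0%N => -[|n] // _ x; apply: I0.
split.
- by case=> [|n]; [exact: MI | move=> A B j f jI; exists 0 => x; apply/esym/I0].
- by move=> x y.
- by move=> y; split=> [_|[x <-]]; [exists y | ].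
- by move=> n y; split=> [_|//]; exists 0; rewrite (I0 _ y).
Qed.

Lemma cosyzygy_finite_dim n :
  finite_injective_dimension (Cz R n.+1) -> finite_injective_dimension (Cz R n).
Proof.
move=> [I [e [d [[II eI ex0 ex] [N NE]]]]].
pose J m : lmodType R := if m is m'.+1 then I m' else Ez R n.
pose dJ m : {linear J m -> J m.+1} :=
  match m return {linear J m -> J m.+1} with
  | 0 => (e \o qz R n : {linear Ez R n -> I 0%N})
  | m'.+1 => d m'
  end.
exists J, (jz R n), dJ; split; last by exists N.+1 => -[|m] //; apply: NE.
split.
- by case=> [|m]; [exact: cosyz_injP | exact: II].
- exact: jzI.
- move=> y; rewrite /dJ /=; split=> [/(injective_eq0 eI)/cosyz_ex//|[x <-]].
  by rewrite /= qjz linear0.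
- case=> [|m] y; last exact: ex.
  rewrite /dJ /=; split=> [/ex0[x <-]|[x <-]]; last by apply/ex0; exists (qz R n x).
  by have [z <-] := qzS x; exists z.
Qed.

Lemma residue_van_gorenstein n0 : (forall n, (n0 <= n)%N -> van n K) -> gorenstein R.
Proof.
move=> Kv; have : finite_injective_dimension (Cz R n0).
  apply/injective_finite_dim/cyclic_van_injective => A Q i q [iI qS iq].
  exact: (van_cyclic Kv (submod_img i) qS iq).
by elim: n0 {Kv} => [//|n IH] /cosyzygy_finite_dim.
Qed.
End FiniteInjectiveDimension.

(** * Fitting decomposition over a henselian local ring *)

Section Fitting.
Variable R : comNzRingType.
Variables (k : fieldType) (pi : {rmorphism R -> k}).
Hypothesis piS : surjective pi.
Hypothesis piU : forall x, pi x != 0 -> exists y, x * y = 1.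
Hypothesis hensel : forall (f : {poly R}) (g0 h0 : {poly k}),
    f \is monic -> g0 \is monic -> h0 \is monic -> coprimep g0 h0 ->
    map_poly pi f = g0 * h0 ->
    exists g h : {poly R},
      [/\ g \is monic, h \is monic, f = g * h,
          map_poly pi g = g0 & map_poly pi h = h0].

Lemma map_poly_surj (p0 : {poly k}) : exists p : {poly R}, map_poly pi p = p0.
Proof.
elim/poly_ind: p0 => [|p0 c [p pE]]; first by exists 0; rewrite rmorph0.
have [d dE] := piS c; exists (p * 'X + d%:P).
by rewrite rmorphD rmorphM /= map_polyX map_polyC /= pE dE.
Qed.

Lemma poly_divX (A : comNzRingType) (p : {poly A}) : exists q, p = q * 'X + (p`_0)%:P.
Proof.
elim/poly_ind: p => [|p c _]; first by exists 0; rewrite coef0 mul0r addr0.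
by exists p; rewrite coefD coefMX coefC /= add0r.
Qed.

Lemma horner_mx_comp n (A : 'M[R]_n.+1) q p :
  exists r, horner_mx (horner_mx A q) p = horner_mx A r.
Proof.
elim/poly_ind: p => [|p c [r rE]]; first by exists 0; rewrite !rmorph0.
exists (r * q + c%:P).
by rewrite !(rmorphD, rmorphM) /= !horner_mx_C horner_mx_X rE.
Qed.

(** The matrix q(A) reduces to the identity, so its determinant is a unit. Cayley-Hamilton makes its
    inverse a polynomial in [A], as is needed for acting on a quotient of the free module on which
    only polynomials in [A] are known to descend. *)
Lemma horner_mx_unit n (A : 'M[R]_n.+1) q : map_poly pi q = 1 ->
  exists r, horner_mx A (q * r) = 1.
Proof.
move=> q1; pose B := horner_mx A q.
have detB : pi (\det B) != 0.
  rewrite -det_map_mx map_horner_mx q1 rmorph1 det1 oner_eq0 //.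
have [d dB] := piU detB.
have [c cE] := poly_divX (char_poly B).
have [r rE] := horner_mx_comp A q c.
have := Cayley_Hamilton B; rewrite cE rmorphD rmorphM /= horner_mx_X horner_mx_C.
rewrite char_poly_det rE => /eqP; rewrite addr_eq0 => /eqP BE.
(* The constant term of the characteristic polynomial is (-1)^(n+1) det B, the size being n + 1, so
   c(B) B = -(-1)^(n+1) det B; [e] inverts this scalar. *)
pose e := - ((-1) ^+ n.+1 * d); exists (r * e%:P).
rewrite mulrA [q * r]mulrC rmorphM rmorphM /= -/B BE horner_mx_C -rmorphN.
rewrite -[_ * _]scalar_mxM /e mulrNN mulrACA -expr2 sqrr_sign dB mulr1 //.
Qed.

(** [M] becomes an R[X]-module with X acting as [phi]. The action passes through a finite R-algebra,
    in which elements congruent to 1 modulo the maximal ideal are units; this is the source of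
    [pactV]. *)
Record poly_action M (phi : {linear M -> M}) := PolyAction {
  pact :> {poly R} -> {linear M -> M};
  pact_poly : {poly R};
  pact_monic : pact_poly \is monic;
  pact0 : forall x, pact pact_poly x = 0;
  pactD : forall a b x, pact (a + b) x = pact a x + pact b x;
  pactM : forall a b x, pact (a * b) x = pact a (pact b x);
  pactC : forall c x, pact c%:P x = c *: x;
  pactX : forall x, pact 'X x = phi x;
  pactV : forall q, map_poly pi q = 1 -> exists r, forall x, pact (q * r) x = x }.

Lemma poly_action_exists (M : lmodType R) (phi : {linear M -> M}) :
  finitely_generated M -> exists E : poly_action phi, True.
Proof.
move=> /fg_cover[[|n] [T TS]].
  (* Without generators [M] is zero; the case is separate because [horner_mx] needs a matrix of
     positive size. *)
  have M0 (x : M) : x = 0.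
    by have [v <-] := TS x; rewrite linear_rV big_ord0.
  by unshelve eexists (@PolyAction M phi (fun=> 0) 1 _ _ _ _ _ _ _) => // *;
     rewrite ?monic1 //; try exists 0; intros; apply/esym/M0.
have /choice[r rE] (i : 'I_n.+1) : exists w, T w = phi (T (delta_mx 0 i)) by apply: TS.
pose A := \matrix_i r i.
have TA v : T (v *m A) = phi (T v).
  rewrite mulmx_sum_row linear_sum [RHS](linear_rV (phi \o T) v).
  by apply: eq_bigr => i _; rewrite linearZZ rowK rE.
have key p : exists e : {linear M -> M}, forall v, e (T v) = T (v *m horner_mx A p).
  elim/poly_ind: p => [|p c [e eE]].
    by exists 0 => v; rewrite rmorph0 mulmx0 linear0.
  exists ((phi \o e) \+ c \*: idfun) => v /=.
  rewrite rmorphD rmorphM /= horner_mx_X horner_mx_C mulmxDr linearD mulmxA TA eE.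
  by rewrite mul_mx_scalar linearZZ.
have [E EE] := choice key.
have Efun p (f : {linear M -> M}) :
    (forall v, f (T v) = T (v *m horner_mx A p)) -> forall x, E p x = f x.
  by move=> fE x; have [v <-] := TS x; rewrite EE fE.
unshelve eexists (@PolyAction M phi E (char_poly A) _ _ _ _ _ _ _) => //.
- exact: char_poly_monic.
- by apply: (Efun _ 0) => v; rewrite Cayley_Hamilton mulmx0 linear0.
- by move=> a b; apply: (Efun _ (E a \+ E b)) => v /=; rewrite !EE rmorphD mulmxDr linearD.
- move=> a b; apply: (Efun _ (E a \o E b)) => v /=.
  by rewrite !EE mulrC rmorphM mulmxA.
- move=> c; apply: (Efun _ (c \*: idfun)) => v /=.
  by rewrite horner_mx_C mul_mx_scalar linearZZ.
- by apply: Efun => v; rewrite horner_mx_X TA.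
- move=> q /(horner_mx_unit A)[s qs]; exists s.
  by apply: (Efun _ idfun) => v /=; rewrite qs mulmx1.
Qed.

Variables (K : lmodType R).
Hypothesis Kpi : forall r (y : K), pi r = 0 -> r *: y = 0.

(* A monic polynomial killing phi reduces to X^a h0 with h0(0) <> 0; the lifted
   coprime factorization splits M into a part on which phi^a maps into mM and
   a part on which phi is invertible, with projections e1 and e2. *)
Lemma fitting (M : lmodType R) (phi : {linear M -> M}) : finitely_generated M ->
  exists e1 e2 w : {linear M -> M},
  [/\ forall x, e1 x + e2 x = x, forall x, e1 (e2 x) = 0, forall x, e2 (e1 x) = 0,
      forall f : {linear M -> K}, (forall x, f (phi x) = f x) -> forall x, f (e1 x) = 0
    & forall x, w (phi (e2 x)) = e2 x /\ phi (w (e2 x)) = e2 x].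
Proof.
move=> Mfg; have [E _] := poly_action_exists phi Mfg.
pose p := pact_poly E.
have p0M : map_poly pi p \is monic by apply/monic_map/pact_monic.
have [a [h0]] := multiplicity_XsubC (map_poly pi p) 0.
rewrite monic_neq0 // implyTb polyC0 subr0 => h00 pE.
have h0M : h0 \is monic by rewrite -(monicMr _ (monicXn _ a)) -pE.
have cop : coprimep 'X^a h0.
  by apply/coprimep_expl; rewrite coprimep_sym -['X]subr0 -polyC0 coprimep_XsubC.
have [|g [h [gM hM pgh gX hh0]]] := hensel (pact_monic E) (monicXn _ a) h0M cop.
  by rewrite -/p pE mulrC.
have [[u0 v0] /= /eqpf_eq[c c0 uvE]] := Bezout_coprimepP _ _ cop.
have [u uE] := map_poly_surj (c^-1 *: u0); have [v vE] := map_poly_surj (c^-1 *: v0).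
have [|s sE] := @pactV M phi E (u * g + v * h).
  rewrite rmorphD !rmorphM /= uE vE gX hh0.
  by rewrite -!scalerAl -scalerDr uvE scalerA mulVf // scale1r.
have p_0 q x : E (q * p) x = 0 by rewrite pactM pact0 linear0.
have comm q r x : E q (E r x) = E r (E q x) by rewrite -!pactM mulrC.
have gh0 q x : E (q * (g * h)) x = 0 by rewrite -pgh p_0.
have [h1 hE] := poly_divX h.
have [|d dh] := piU (x := h`_0).
  by rewrite -coef_map hh0 -horner_coef0 -rootE.
(* [s] inverts u g + v h, so the first two maps add up to the identity, and they annihilate each
   other since g h kills [M]. On the image of the second, h = h1 X + h(0) acts as zero, so -d h1
   inverts X there, [d] being the inverse of h(0). *)
exists (E (v * h * s)), (E (u * g * s)), (E (- (d%:P * h1))); split.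
- by move=> x; rewrite -pactD -mulrDl addrC sE.
- move=> x; rewrite -pactM.
  by rewrite (_ : _ * _ = (v * u * s * s) * (g * h)) ?gh0 //; ring.
- move=> x; rewrite -pactM.
  by rewrite (_ : _ * _ = (v * u * s * s) * (g * h)) ?gh0 //; ring.
- move=> f fphi x.
  have fX q n y : f (E (q * 'X^n) y) = f (E q y).
    elim: n q => [|n IH] q; first by rewrite mulr1.
    by rewrite exprS mulrA IH mulrC pactM pactX fphi.
  have f0 q y : map_poly pi q = 0 -> f (E q y) = 0.
    elim/poly_ind: q y => [|q b IH] y.
      by move=> _; rewrite -polyC0 pactC scale0r linear0.
    rewrite rmorphD rmorphM /= map_polyX map_polyC /= => qb.
    have b0 : pi b = 0.
      have := congr1 (fun t : {poly k} => t`_0) qb.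
      by rewrite coefD coefMX coefC coef0 /= add0r.
    have q0 : map_poly pi q = 0.
      move: qb; rewrite b0 polyC0 addr0 => /eqP.
      by rewrite mulf_eq0 polyX_eq0 orbF => /eqP.
    rewrite pactD linearD (fX q 1%N) IH // add0r pactC linearZZ Kpi //.
  (* [f] does not see the factor X^a. On the image of the first projection [g] acts as zero, so X^a
     may be replaced by X^a - g, whose coefficients lie in the maximal ideal and kill [K]. *)
  rewrite -(fX _ a).
  have -> : v * h * s * 'X^a = (v * s) * (g * h) + ('X^a - g) * (v * h * s) by ring.
  rewrite pactD gh0 add0r pactM; apply: f0.
  by rewrite rmorphB /= map_polyXn gX subrr.
- move=> x.
  have key : E (- (d%:P * h1) * 'X * (u * g * s)) x = E (u * g * s) x.
    have -> : - (d%:P * h1) * 'X * (u * g * s) =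
       - (d%:P * u * s) * (g * h) + (h`_0 * d)%:P * (u * g * s).
      by rewrite {1}hE polyCM; ring.
    by rewrite pactD gh0 add0r dh mul1r.
  split; first by rewrite -(pactX E) -!pactM.
  by rewrite -(pactX E) -!pactM ['X * _]mulrC.
Qed.
End Fitting.

(** * Totally reflexive approximations of the residue field *)

Section Isomorphic.
Variable R : comNzRingType.
Implicit Types M N L : lmodType R.

Lemma isomorphic_inv M N : isomorphic M N ->
  exists (f : {linear M -> N}) (g : {linear N -> M}),
    (forall x, g (f x) = x) /\ forall y, f (g y) = y.
Proof.
move=> [f [g gK Kg]]; have [|h hE] := @linear_of _ N M g.
  by move=> a x y; apply: (can_inj gK); rewrite Kg linearP !Kg.
by exists f, h; split=> x; rewrite hE.
Qed.

Lemma isomorphic_sym M N : isomorphic M N -> isomorphic N M.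
Proof. by move=> /isomorphic_inv[f [g [gf fg]]]; exists g, f. Qed.

Lemma isomorphic_swap M N L : isomorphic L (M * N)%type -> isomorphic L (N * M)%type.
Proof.
move=> /isomorphic_inv[f [g [gf fg]]].
have [|h hE] := @linear_of _ L (N * M)%type (fun x => ((f x).2, (f x).1)).
  by move=> a x y; rewrite !linearP.
exists h, (fun z => g (z.2, z.1)) => [x|[y z]].
  by rewrite hE /= -surjective_pairing gf.
by rewrite hE fg.
Qed.

Lemma isomorphic_fst M N L : isomorphic L (M * N)%type ->
  exists (i : {linear M -> L}) (p : {linear L -> M}), forall x, p (i x) = x.
Proof.
move=> /isomorphic_inv[f [g [gf fg]]].
have [|i iE] := @linear_of _ M L (fun x => g (x, 0)).
  by move=> a x y; rewrite -linearP pairZ pairD scaler0 addr0.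
have [|p pE] := @linear_of _ L M (fun x => (f x).1).
  by move=> a x y; rewrite linearP.
by exists i, p => x; rewrite pE iE fg.
Qed.
End Isomorphic.

Section Finiteness.
Variable R : comNzRingType.
Hypothesis noethR : noetherian R.

Definition finite_TR_type := exists s : seq (lmodType R),
  (forall M, List.In M s -> TR M) /\
  forall M : lmodType R, TR M -> indecomposable M -> exists2 N, List.In N s & isomorphic M N.

Lemma infinite_TR_type : ~ finite_TR_type ->
  exists F : nat -> lmodType R,
    (forall i, TR (F i) /\ indecomposable (F i)) /\
    (forall i j, isomorphic (F i) (F j) -> i = j).
Proof.
move=> nF.
have next (s : seq (lmodType R)) : exists M : lmodType R,
    (forall N, List.In N s -> TR N) ->
    [/\ TR M, indecomposable M & forall N, List.In N s -> ~ isomorphic M N].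
  (* [R^o] is a default value that makes the choice function total; the lists built below consist of
     totally reflexive modules. *)
  have [sT|sT] := pselect (forall N, List.In N s -> TR N); last by exists R^o.
  apply: contrapT => nM; apply: nF; exists s; split=> // M MT Mi.
  apply: contrapT => nN; apply: nM; exists M => _; split=> // N Ns MN.
  by apply: nN; exists N.
have [nx nxP] := choice next.
pose s := fix s n := if n is n'.+1 then nx (s n') :: s n' else [::].
have sT n N : List.In N (s n) -> TR N.
  elim: n N => [//|n IH] N /= [<-|/IH//].
  by have [] := nxP _ IH.
exists (fun n => nx (s n)); split=> [i|].
  by have [] := nxP (s i) (sT i).
have sin m n : (m < n)%N -> List.In (nx (s m)) (s n).
  elim: n => [//|n IH]; rewrite ltnS leq_eqVlt => /orP[/eqP ->|/IH mn] /=.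
    by left.
  by right.
have lt m n : (m < n)%N -> ~ isomorphic (nx (s n)) (nx (s m)).
  by move=> /sin; have [_ _] := nxP (s n) (sT n); apply.
move=> i j ij; have [ij'|ij'|//] := ltngtP i j; case: (lt _ _ ij') => //.
exact: isomorphic_sym.
Qed.

Variables (k : fieldType) (pi : {rmorphism R -> k}).
Hypothesis piU : forall x, pi x != 0 -> exists y, x * y = 1.
Variables (K : lmodType R) (q0 : {linear R^o -> K}).
Hypotheses (q0S : surjective q0) (q0E : forall x, q0 x = 0 <-> pi x = 0).
Implicit Types M N L X G : lmodType R.

Lemma K_kill r (y : K) : pi r = 0 -> r *: y = 0.
Proof.
move=> r0; have [s <-] := q0S y; rewrite -linearZZ; apply/q0E.
by rewrite /= rmorphM r0 mul0r.
Qed.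

(* [rank_ge M t] says that M/mM has dimension at least t over the residue
   field, in the form of t functionals to K with a dual family. *)
Definition rank_ge M t := exists (x : 'I_t -> M) (f : 'I_t -> {linear M -> K}),
  forall i j, f i (x j) = q0 (i == j)%:R.

Lemma rank_ge0 M : rank_ge M 0.
Proof. by exists (fun=> 0), (fun=> 0) => -[]. Qed.

(** Lifting the dual family to R^s and reducing factors the identity matrix of size t over [k]
    through k^s. *)
Lemma rank_ge_bound s t M (T : {linear 'rV[R]_s -> M}) :
  surjective T -> rank_ge M t -> (t <= s)%N.
Proof.
move=> TS [x [f fx]].
(* [ka] identifies [K] with [k]; it is semilinear along [pi], as [k] carries no R-module structure
   here. *)
have [ka kaE] : exists ka : K -> k, forall r, ka (q0 r) = pi r.
  have /choice[c cE] := q0S; exists (fun y => pi (c y)) => r.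
  apply/eqP; rewrite -subr_eq0 -rmorphB; apply/eqP/q0E.
  by rewrite linearB cE subrr.
have kaP a y z : ka (a *: y + z) = pi a * ka y + ka z.
  have [r <-] := q0S y; have [r' <-] := q0S z.
  by rewrite -linearP !kaE rmorphD rmorphM.
have ka0 : ka 0 = 0 by rewrite -(linear0 q0) kaE rmorph0.
have /choice[v vE] (j : 'I_t) : exists v, T v = x j by apply: TS.
pose A := \matrix_(j < t, l < s) pi (v j 0 l).
pose B := \matrix_(l < s, i < t) ka (f i (T (delta_mx 0 l))).
apply: (@mulmx1_min k t s A B); apply/matrixP => j i; rewrite !mxE.
under eq_bigr do rewrite !mxE.
have -> : (j == i)%:R = ka (f i (x j)) by rewrite fx kaE rmorph_nat eq_sym.
rewrite -vE -[f i _]/((f i \o T) _) linear_rV.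
elim/big_rec2: _ => //= l y z _ ->; by rewrite kaP.
Qed.

Lemma rank_ge_retract t M L (i : {linear M -> L}) (p : {linear L -> M}) :
  (forall x, p (i x) = x) -> rank_ge M t -> rank_ge L t.
Proof.
move=> ip [x [f fx]]; exists (i \o x), (fun a => f a \o p) => a b /=.
by rewrite ip fx.
Qed.

Lemma rank_ge_prod s t M N : rank_ge M s -> rank_ge N t -> rank_ge (M * N)%type (s + t).
Proof.
move=> [x [f fx]] [y [g gy]].
have [|p1 p1E] := @linear_of _ (M * N)%type M (fun z => z.1) => //.
have [|p2 p2E] := @linear_of _ (M * N)%type N (fun z => z.2) => //.
exists (fun a => match split a with inl b => (x b, 0) | inr b => (0, y b) end),
  (fun a => match split a with inl b => (f b \o p1 : {linear _ -> _})
     | inr b => (g b \o p2 : {linear _ -> _}) end) => i j.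
rewrite -(inj_eq (can_inj (@splitK _ _))).
case: (split i) => a; case: (split j) => b /=; rewrite ?p1E ?p2E /= ?fx ?gy //.
all: by rewrite !linear0.
Qed.

Lemma rank_ge1 M : finitely_generated M -> ~ zero_module M -> rank_ge M 1.
Proof.
move=> /(minimal_cover piU)[[|s] [T [TS Tm]]] M0.
  by case: M0 => x; have [v <-] := TS x; rewrite linear_rV big_ord0.
have [|c cE] := @linear_of _ 'rV[R]_s.+1 K (fun v => q0 (v 0 ord0)).
  by move=> a u v; rewrite !mxE -linearP.
have [|f fE] := descend (f := c) TS.
  by move=> v /Tm v0; rewrite cE; apply/q0E.
exists (fun=> T (delta_mx 0 ord0)), (fun=> f) => i j.
by rewrite fE cE mxE !ord1 eqxx.
Qed.

Definition rank_lt M n := forall t, rank_ge M t -> (t < n)%N.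

Lemma rank_lt_exists M : finitely_generated M -> exists n, rank_lt M n.
Proof.
by move=> /fg_cover[s [T TS]]; exists s.+1 => t /(rank_ge_bound TS).
Qed.

Lemma rank_lt_factor M N L n : isomorphic L (M * N)%type ->
  finitely_generated N -> ~ zero_module N -> rank_lt L n.+1 -> rank_lt M n.
Proof.
move=> /isomorphic_inv[f [g [gf fg]]] Nfg N0 Ln t Mt.
rewrite -ltnS -[t.+1]addn1; apply: Ln.
exact: (rank_ge_retract fg (rank_ge_prod Mt (rank_ge1 Nfg N0))).
Qed.

(** The induction is on the rank over the residue field, to which each nonzero summand contributes
    at least one. Stating it for a predicate avoids handling lists of indecomposable summands. *)
Lemma TR_decomposition (P : lmodType R -> Prop) :
  (forall M, zero_module M -> P M) ->
  (forall M, TR M -> indecomposable M -> P M) ->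
  (forall M N L, isomorphic L (M * N)%type -> P M -> P N -> P L) ->
  forall M, TR M -> P M.
Proof.
move=> P0 Pi PP M MT; have [n Mn] := rank_lt_exists (TR_fg MT).
elim: n M MT Mn => [|n IH] M MT Mn; first by have := Mn 0%N (rank_ge0 M).
have [M0|M0] := pselect (zero_module M); first exact: P0.
have [Mi|Mi] := pselect (indecomposable M); first exact: Pi.
have [N1 [N2 [MN N10 N20]]] : exists N1 N2 : lmodType R,
    [/\ isomorphic M (N1 * N2)%type, ~ zero_module N1 & ~ zero_module N2].
  apply: contrapT => nN; apply: Mi; split=> // N1 N2 MN.
  have [N10|N10] := pselect (zero_module N1); first by left.
  right; apply: contrapT => N20; apply: nN; by exists N1, N2.
have NM := isomorphic_swap MN.
have [i1 [p1 ip1]] := isomorphic_fst MN; have [i2 [p2 ip2]] := isomorphic_fst NM.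
have N1T := TR_retract ip1 MT; have N2T := TR_retract ip2 MT.
by apply: (PP _ _ _ MN); apply: IH => //;
  [exact: (rank_lt_factor MN (TR_fg N2T)) | exact: (rank_lt_factor NM (TR_fg N1T))].
Qed.

Definition factors X (f : {linear X -> K}) G (g : {linear G -> K}) :=
  exists h : {linear G -> X}, forall x, f (h x) = g x.

Definition approximates X (f : {linear X -> K}) :=
  forall G, TR G -> forall g : {linear G -> K}, factors f g.

Lemma approx_add X (f : {linear X -> K}) G (l : seq {linear G -> K}) :
  TR X -> TR G -> exists X' (f' : {linear X' -> K}),
  [/\ TR X', forall G' (g : {linear G' -> K}), factors f g -> factors f' g
    & forall g, g \in l -> factors f' g].
Proof.
move=> XT GT; elim: l => [|g l [X' [f' [X'T ff' f'l]]]]; first by exists X, f.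
have [|f'' f''E] := @linear_of _ (X' * G)%type K (fun z => f' z.1 + g z.2).
  by move=> a x y; rewrite !linearP scalerDr addrACA.
have [|i1 i1E] := @linear_of _ X' (X' * G)%type (fun x => (x, 0)).
  by move=> a x y; rewrite pairZ pairD scaler0 addr0.
have [|i2 i2E] := @linear_of _ G (X' * G)%type (fun x => (0, x)).
  by move=> a x y; rewrite pairZ pairD scaler0 addr0.
have f'f'' G' (h : {linear G' -> K}) : factors f' h -> factors f'' h.
  by move=> [u uE]; exists (i1 \o u) => x; rewrite /= i1E f''E /= linear0 addr0.
exists (X' * G)%type, f''; split; first exact: TR_prod.
  by move=> G' h /ff'/f'f''.
move=> h; rewrite inE => /orP[/eqP ->|/f'l/f'f''//].
by exists i2 => x; rewrite i2E f''E /= linear0 add0r.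
Qed.

Lemma K_fg : finitely_generated K.
Proof. exact: fg_surj q0S (fg_regular R). Qed.

Lemma approx_list (s : seq (lmodType R)) : (forall M, List.In M s -> TR M) ->
  exists X (f : {linear X -> K}), TR X /\
    forall G, List.In G s -> forall g : {linear G -> K}, factors f g.
Proof.
elim: s => [|G s IH] sT.
  by exists ('rV[R]_0 : lmodType R), 0; split=> //; apply: TR_rV.
have [M Ms|X [f [XT fs]]] := IH; first by apply: sT; right.
have GT : TR G by apply: sT; left.
(* As Hom(G, K) is finitely generated and the maps that factor form a submodule, adding finitely
   many copies of [G] takes care of every map from [G]. *)
have /fg_span[l lE] := fg_hom noethR (TR_fg GT) K_fg.
have [X' [f' [X'T ff' f'l]]] := approx_add f l XT GT.
exists X', f'; split=> // G' /= [<-|G's] g; last exact/ff'/fs.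
apply: (span_sub (S := fun g => factors f' g)) f'l _ (lE g).
split=> [|a u v [hu huE] [hv hvE]]; first by exists 0 => x; rewrite linear0.
by exists (a *: hu + hv) => x /=; rewrite linearP huE hvE.
Qed.

Lemma approximation_exists : finite_TR_type ->
  exists X (f : {linear X -> K}), TR X /\ approximates f.
Proof.
move=> [s [sT si]]; have [X [f [XT fs]]] := approx_list sT.
exists X, f; split=> // G GT.
elim/TR_decomposition: GT => {G} [M M0|M MT Mi|M N L LMN Mf Nf] g.
- by exists 0 => x; rewrite (M0 x) !linear0.
- have [N Ns /isomorphic_inv[u [v [vu uv]]]] := si M MT Mi.
  have [h hE] := fs N Ns (g \o v).
  by exists (h \o u) => x; rewrite /= hE /= vu.
- have [u [v [vu uv]]] := isomorphic_inv LMN.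
  have [|i1 i1E] := @linear_of _ M (M * N)%type (fun x => (x, 0)).
    by move=> a x y; rewrite pairZ pairD scaler0 addr0.
  have [|i2 i2E] := @linear_of _ N (M * N)%type (fun x => (0, x)).
    by move=> a x y; rewrite pairZ pairD scaler0 addr0.
  have [h1 h1E] := Mf (g \o v \o i1); have [h2 h2E] := Nf (g \o v \o i2).
  have [|h hE] := @linear_of _ L X (fun x => h1 (u x).1 + h2 (u x).2).
    by move=> a x y; rewrite !linearP scalerDr addrACA.
  exists h => x; rewrite hE linearD h1E h2E /= i1E i2E -!linearD.
  by rewrite pairD addr0 add0r -surjective_pairing vu.
Qed.

Hypothesis piS : surjective pi.
Hypothesis hensel : forall (f : {poly R}) (g0 h0 : {poly k}),
    f \is monic -> g0 \is monic -> h0 \is monic -> coprimep g0 h0 ->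
    map_poly pi f = g0 * h0 ->
    exists g h : {poly R},
      [/\ g \is monic, h \is monic, f = g * h,
          map_poly pi g = g0 & map_poly pi h = h0].

Definition right_minimal X (f : {linear X -> K}) :=
  forall phi : {linear X -> X}, (forall x, f (phi x) = f x) ->
  exists w : {linear X -> X}, (forall x, w (phi x) = x) /\ forall x, phi (w x) = x.

(** Take an approximation of least rank. The Fitting component on which [phi] is nilpotent modulo
    the maximal ideal is killed by [f], so the other component still approximates; by leastness the
    killed one is zero, and then [phi] is invertible. *)
Lemma minimal_approximation : finite_TR_type ->
  exists X (f : {linear X -> K}), [/\ TR X, approximates f & right_minimal f].
Proof.
move=> fin.
pose P n := `[< exists X (f : {linear X -> K}), [/\ TR X, approximates f & rank_lt X n] >].
have [|n /asboolP[X [f [XT fA Xn]]] nmin] := @ex_minnP P.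
  have [X [f [XT fA]]] := approximation_exists fin.
  by have [n Xn] := rank_lt_exists (TR_fg XT); exists n; apply/asboolP; exists X, f.
exists X, f; split=> // phi fphi.
have [e1 [e2 [w [e12 e1e2 e2e1 fe1 we2]]]] :=
  fitting piS piU hensel K_kill phi (TR_fg XT).
have e1e1 x : e1 (e1 x) = e1 x by rewrite -[in RHS](e12 x) linearD e1e2 addr0.
have e2e2 x : e2 (e2 x) = e2 x by rewrite -[in RHS](e12 x) linearD e2e1 add0r.
suff e10 x : e1 x = 0.
  have e2id x : e2 x = x by rewrite -[RHS](e12 x) e10 add0r.
  by exists w; split=> x; have [] := we2 x; rewrite e2id.
have [X1 [i1 [i1I i1E]]] := submodule_exists (submod_img e1).
have [X2 [i2 [i2I i2E]]] := submodule_exists (submod_img e2).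
have [|p1 p1E] := lift_inj (f := e1) i1I; first by move=> y; apply/i1E; exists y.
have [|p2 p2E] := lift_inj (f := e2) i2I; first by move=> y; apply/i2E; exists y.
have ip1 y : p1 (i1 y) = y.
  apply: i1I; rewrite p1E; have /i1E[z <-] : exists z, i1 z = i1 y by exists y.
  exact: e1e1.
have ip2 y : p2 (i2 y) = y.
  apply: i2I; rewrite p2E; have /i2E[z <-] : exists z, i2 z = i2 y by exists y.
  exact: e2e2.
have p1i2 y : p1 (i2 y) = 0.
  apply: i1I; rewrite p1E linear0.
  by have /i2E[z <-] : exists z, i2 z = i2 y by exists y.
have p2i1 y : p2 (i1 y) = 0.
  apply: i2I; rewrite p2E linear0.
  by have /i1E[z <-] : exists z, i1 z = i1 y by exists y.
have X2T := TR_retract ip2 XT; have X1T := TR_retract ip1 XT.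
have iso : isomorphic X (X2 * X1)%type.
  have [|h hE] := @linear_of _ X (X2 * X1)%type (fun x => (p2 x, p1 x)).
    by move=> a y z; rewrite !linearP.
  exists h, (fun z => i2 z.1 + i1 z.2) => [y|[y z]].
    by rewrite hE /= p1E p2E addrC e12.
  by rewrite hE !linearD ip1 ip2 p1i2 p2i1 addr0 add0r.
have [X10|X10] := pselect (zero_module X1).
  by rewrite -p1E (X10 (p1 x)) linear0.
case: n Xn nmin => [|n] Xn nmin; first by have := Xn 0%N (rank_ge0 X).
suff /nmin : P n by rewrite ltnn.
apply/asboolP; exists X2, (f \o i2); split=> //; last first.
  exact: rank_lt_factor iso (TR_fg X1T) X10 Xn.
move=> G GT g; have [h hE] := fA G GT g; exists (p2 \o h) => y /=.
by rewrite p2E -hE -[in RHS](e12 (h y)) linearD fe1 // add0r.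
Qed.

(** The conclusion is Ext^1(G, Y) = 0 read on a presentation of [G]. The pushout [P] is totally
    reflexive, so [f] extended by zero on the free module factors as f h; right minimality inverts
    [h \o jx], which yields a retraction of [P] onto [X]. Restricted to the free module it lands in
    the kernel [Y] of [f] and extends [a]. *)
Lemma wakamatsu X (f : {linear X -> K}) (Y : lmodType R) (u : {linear Y -> X}) :
  TR X -> approximates f -> right_minimal f -> exact_at u f -> injective u ->
  forall s (G L : lmodType R) (i : {linear L -> 'rV[R]_s}) (T : {linear 'rV[R]_s -> G}),
  TR G -> ses i T -> forall a : {linear L -> Y},
  exists b : {linear 'rV[R]_s -> Y}, forall x, b (i x) = a x.
Proof.
move=> XT fA fmin uf uI s G L i T GT iT a; have [iI TS iE] := iT.
have Ti0 y : T (i y) = 0 by apply/iE; exists y.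
have fu0 y : f (u y) = 0 by apply/uf; exists y.
(* P is the pushout of u a and i, an extension of G by X *)
have [|d dE] := @linear_of _ L (X * 'rV[R]_s)%type (fun y => (- u (a y), i y)).
  by move=> r y z; rewrite !linearP.
have [P [q [qS qE]]] := quotient_exists (submod_img d).
have [|jx jxE] := @linear_of _ X P (fun x => q (x, 0)).
  by move=> r x y; rewrite -linearP pairZ pairD scaler0 addr0.
have [|jF jFE] := @linear_of _ 'rV[R]_s P (fun v => q (0, v)).
  by move=> r x y; rewrite -linearP pairZ pairD scaler0 addr0.
have [|t tE] := @linear_of _ (X * 'rV[R]_s)%type G (fun z => T z.2).
  by move=> r x y; rewrite linearP.
have [|p pE] := descend (f := t) qS.
  by move=> z /qE[y <-]; rewrite tE dE /= Ti0.
have jp : ses jx p.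
  split.
  - apply: linear_inj => x; rewrite jxE => /qE[y]; rewrite dE => -[<- iy0].
    by rewrite (injective_eq0 iI iy0) !linear0 ?oppr0.
  - by move=> g; have [v <-] := TS g; exists (q (0, v)); rewrite pE tE.
  - move=> y; have [[x v] <-] := qS y; rewrite pE tE /=; split.
      move=> /iE[z <-]; exists (x + u (a z)); rewrite jxE.
      apply/subr0_eq; rewrite -linearB; apply/qE; exists (- z).
      by rewrite dE !linearN opprK pairN pairD sub0r addrAC subrr add0r.
    by move=> [z]; rewrite jxE => /(congr1 p); rewrite !pE !tE /= linear0 => <-.
have PT := TR_ses noethR jp XT GT.
have [|fx fxE] := @linear_of _ (X * 'rV[R]_s)%type K (fun z => f z.1).
  by move=> r x y; rewrite linearP.
have [|f' f'E] := descend (f := fx) qS.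
  by move=> z /qE[y <-]; rewrite fxE dE /= linearN fu0 oppr0.
have [h hE] := fA P PT f'.
have [x|w [wl wr]] := fmin (h \o jx); first by rewrite /= hE jxE f'E fxE.
have fw x : f (w x) = f x.
  by rewrite -[in RHS](wr x) /= hE jxE f'E fxE.
have [|b bE] := @lift_inj _ Y X 'rV[R]_s u (w \o h \o jF) uI.
  by move=> v; apply/uf; rewrite /= fw hE jFE f'E fxE /= linear0.
exists b => x; apply: uI; rewrite bE /= -[RHS](wl (u (a x))) /=; congr (w (h _)).
rewrite jFE jxE; apply/subr0_eq; rewrite -linearB; apply/qE; exists x.
by rewrite dE pairN pairD oppr0 addr0 sub0r.
Qed.

End Finiteness.

(** * Conclusion *)

Section MinimalResolution.
Variable R : comNzRingType.
Hypothesis noethR : noetherian R.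
Variables (k : fieldType) (pi : {rmorphism R -> k}).
Hypothesis piU : forall x, pi x != 0 -> exists y, x * y = 1.

(** [ms_nonfree] lets the step be repeated forever, [ms_rank_gt0] makes [K] a summand of the maps
    from the free module to [K], and [ms_min] makes maps from the free module to [X] send the syzygy
    into [Y]. *)
Record min_syzygy (M : lmodType R) := MinSyzygy {
  ms_rank : nat;
  ms_map : {linear 'rV[R]_ms_rank -> M};
  ms_mod : lmodType R;
  ms_incl : {linear ms_mod -> 'rV[R]_ms_rank};
  ms_ses : ses ms_incl ms_map;
  ms_min : forall y j, pi (ms_incl y 0 j) = 0;
  ms_rank_gt0 : (0 < ms_rank)%N;
  ms_TR : TR ms_mod;
  ms_nonfree : ~ free_module ms_mod }.

Lemma min_syzygy_exists (M : lmodType R) : TR M -> ~ free_module M ->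
  exists c : min_syzygy M, True.
Proof.
move=> MT Mf; have [s [T [TS Tm]]] := minimal_cover piU (TR_fg MT).
have [L [i iT]] := ses_ker TS; have [iI _ iE] := iT.
have LT := TR_syzygy noethR iT MT.
have s0 : (0 < s)%N.
  rewrite lt0n; apply/eqP => s0; apply: Mf; exists 0%N.
  have v0 (v : 'rV[R]_s) : v = 0 by apply/rowP => j; have := ltn_ord j; rewrite {2}s0.
  have M0 (x : M) : x = 0.
    by have [v <-] := TS x; rewrite (v0 v) linear0.
  exists 0, (fun=> 0) => [x|x]; first exact/esym/M0.
  by apply/rowP => -[].
have im y j : pi (i y 0 j) = 0 by apply: Tm; apply/iE; exists y.
(* A coordinate of a free [L] of positive rank extends to R^s because Ext^1(M, R) = 0, so by
   minimality its values on [L] lie in the maximal ideal, yet 1 is one of them. In rank 0, [M]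
   itself would be free. *)
have Lf : ~ free_module L.
  move=> [t /isomorphic_inv[f [g [gf fg]]]]; case: t f g gf fg => [|t] f g gf fg.
    apply: Mf; exists s; apply: isomorphic_sym; exists T.
    have TI : injective T.
      apply: linear_inj => v /iE[y <-]; rewrite -(gf y).
      by rewrite (_ : f y = 0) ?linear0 //; apply/rowP => -[].
    have [h hK] := choice TS; exists h => [v|y]; last exact: hK.
    by apply: TI; rewrite hK.
  have [|c cE] := @linear_of _ L R^o (fun y => f y 0 ord0).
    by move=> a x y; rewrite linearP !mxE.
  have [h hE] := van_extends iT (@TR_van _ _ MT 0%N) c.
  have := hE (g (delta_mx 0 ord0)); rewrite cE fg mxE !eqxx linear_rV.
  move=> /(congr1 pi); rewrite [LHS]rmorph_sum big1 => [|j _]; last first.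
    by rewrite rmorphM im mul0r.
  by move=> /esym/eqP; rewrite [pi _]rmorph1 oner_eq0.
by exists (MinSyzygy iT im s0 LT Lf).
Qed.

Definition nonfree_TR := {M : lmodType R | TR M /\ ~ free_module M}.

Definition the_syzygy (M : nonfree_TR) : min_syzygy (sval M) :=
  projT1 (cid (min_syzygy_exists (svalP M).1 (svalP M).2)).

Definition next_syzygy (M : nonfree_TR) : nonfree_TR :=
  exist _ (ms_mod (the_syzygy M)) (conj (ms_TR (the_syzygy M)) (@ms_nonfree _ (the_syzygy M))).

Variables (K : lmodType R) (q0 : {linear R^o -> K}).
Hypotheses (q0S : surjective q0) (q0E : forall x, q0 x = 0 <-> pi x = 0).

Section Approximation.
Variables (X : lmodType R) (f : {linear X -> K}) (Y : lmodType R) (u : {linear Y -> X}).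
Hypotheses (XT : TR X) (fS : surjective f) (uI : injective u) (uf : exact_at u f).
Hypothesis Yext : forall s (G L : lmodType R) (i : {linear L -> 'rV[R]_s})
  (T : {linear 'rV[R]_s -> G}), TR G -> ses i T -> forall a : {linear L -> Y},
  exists b : {linear 'rV[R]_s -> Y}, forall x, b (i x) = a x.

Section Step.
Variables (M : lmodType R) (MT : TR M) (c : min_syzygy M).
Local Notation F := 'rV[R]_(ms_rank c).
Local Notation N := (ms_mod c).

Record hom_sequence := HomSequence {
  hs_i : {linear {linear M -> Y} -> {linear F -> X}};
  hs_p : {linear {linear F -> X} -> {linear N -> Y}};
  hs_v : {linear {linear F -> X} -> {linear F -> K}};
  hs_iI : injective hs_i;
  hs_pvS : forall b w, exists x, hs_p x = b /\ hs_v x = w;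
  hs_ipv : forall x, (hs_p x = 0 /\ hs_v x = 0) <-> exists b, hs_i b = x }.

(* 0 -> Hom(M, Y) -> Hom(F, X) -> Hom(N, Y) x Hom(F, K) -> 0 for a minimal
   presentation 0 -> N -> F -> M -> 0: a map F -> X sends N, which lies in mF,
   to mX, which lies in Y. *)
Lemma hom_sequence_exists : exists h : hom_sequence, True.
Proof.
have [jI TS jE] := ms_ses c; pose T := ms_map c; pose j := ms_incl c.
have Tj0 y : T (j y) = 0 by apply/jE; exists y.
have fu0 y : f (u y) = 0 by apply/uf; exists y.
have [|i iE] := @linear_of _ {linear M -> Y} {linear F -> X} (fun a => u \o (a \o T)).
  by move=> r a b; apply: linear_ext => x /=; rewrite linearP.
have [|v vE] := @linear_of _ {linear F -> X} {linear F -> K} (fun g => f \o g).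
  by move=> r a b; apply: linear_ext => x /=; rewrite linearP.
have [|uN uNE] := @linear_of _ {linear N -> Y} {linear N -> X} (fun a => u \o a).
  by move=> r a b; apply: linear_ext => x /=; rewrite linearP.
have [jX jXE] := precomp_exists X j.
have uNI : injective uN.
  move=> a b /(congr1 (fun g : {linear N -> X} => g : N -> X)); rewrite !uNE => ab.
  by apply: linear_ext => y; apply: uI; apply: (congr1 (@^~ y) ab).
have [|p pE] := @lift_inj _ _ _ _ uN jX uNI.
  move=> g; have [|a aE] := @lift_inj _ Y X N u (g \o j) uI.
    move=> y; apply/uf; rewrite /= linear_rV linear_sum big1 // => l _.
    by rewrite linearZZ (K_kill q0S q0E) // ms_min.
  by exists a; apply: linear_ext => y; rewrite uNE jXE /= aE.
have pE' g y : u (p g y) = g (j y).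
  by rewrite -jXE -pE uNE.
unshelve eexists (@HomSequence i p v _ _ _) => //.
- apply: linear_inj => a a0; apply: linear_ext => y; have [x <-] := TS y.
  apply: (injective_eq0 uI).
  by have := congr1 (fun g : {linear F -> X} => g x) a0; rewrite iE.
(* [g] lifts [w] along [f]; adding [u \o a] corrects its restriction to the syzygy without changing
   the composite with [f]. Such an [a] exists because Ext^1(M, Y) = 0. *)
- move=> b w; have [g gE] := projective_rV (p := f) w fS.
  have [a aE] := Yext MT (ms_ses c) (b - p g).
  exists (g \+ (u \o a) : {linear F -> X}); split; apply: linear_ext => y.
    apply: uI; rewrite pE' /= aE linearD linearN pE' addrC subrK //.
  by rewrite vE /= linearD fu0 addr0 gE.
- move=> g; split=> [[pg vg]|[b <-]].
    have [|a aE] := @lift_inj _ Y X F u g uI.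
      by move=> x; apply/uf; have := congr1 (fun h : {linear F -> K} => h x) vg; rewrite vE.
    have [|b bE] := ses_descend (ms_ses c) (f := a).
      by move=> y; apply: uI; rewrite aE -pE' pg.
    by exists b; apply: linear_ext => x; rewrite iE /= bE aE.
  split; apply: linear_ext => y; last by rewrite vE iE /= fu0.
  by apply: (injective_eq0 uI); rewrite pE' iE /= Tj0 !linear0.
Qed.
End Step.

Definition the_hom_sequence (M : nonfree_TR) : hom_sequence (the_syzygy M) :=
  projT1 (cid (hom_sequence_exists (svalP M).1 (the_syzygy M))).

Lemma approximation_van (M : nonfree_TR) :
  exists n0, forall n, (n0 <= n)%N -> van n K.
Proof.
pose Z n := iter n next_syzygy M.
pose s n := ms_rank (the_syzygy (Z n)).
have [||n0 n0E] := @chain_van R noethR (fun n => {linear sval (Z n) -> Y})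
  (fun n => {linear 'rV[R]_(s n) -> X}) (fun n => {linear 'rV[R]_(s n) -> K})
  (fun n => hs_i (the_hom_sequence (Z n))) (fun n => hs_p (the_hom_sequence (Z n)))
  (fun n => hs_v (the_hom_sequence (Z n)))
  (fun n => @hs_iI _ _ (the_hom_sequence (Z n)))
  (fun n => @hs_pvS _ _ (the_hom_sequence (Z n)))
  (fun n => @hs_ipv _ _ (the_hom_sequence (Z n))).
- by move=> n; apply/van_hom_rV/TR_van.
- apply: fg_hom => //; first by apply: TR_fg; apply: (svalP (Z 0%N)).1.
  exact: (fg_inj noethR uI (TR_fg XT)).
exists n0 => n /n0E Vv.
(* The rank is positive, so a coordinate [o] exists and exhibits [K] as a direct summand of Hom(R^(s
   n), K). *)
have o : 'I_(s n) := Ordinal (ms_rank_gt0 (the_syzygy (Z n))).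
have vL (y : K) : linear (fun v : 'rV[R]_(s n) => v 0 o *: y).
  by move=> a b v; rewrite !mxE scalerDl scalerA.
have [|i iE] := @linear_of _ K {linear 'rV[R]_(s n) -> K} (fun y => mklin (vL y)).
  by move=> a y z; apply: linear_ext => v /=; rewrite scalerDr !scalerA mulrC.
have [|p pE] := @linear_of _ {linear 'rV[R]_(s n) -> K} K (fun g => g (delta_mx 0 o)).
  by [].
apply: (van_retract (i := i) (p := p)) Vv => y.
by rewrite pE iE /= mxE !eqxx scale1r.
Qed.
End Approximation.
End MinimalResolution.

Theorem theorem1p3 (R : comNzRingType) :
  noetherian R -> henselian_local_ring R -> ~ gorenstein R ->
  (exists M : lmodType R,
     [/\ totally_reflexive M, cyclic_module M & ~ free_module M]) ->
  exists F : nat -> lmodType R,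
    (forall i, totally_reflexive (F i) /\ indecomposable (F i)) /\
    (forall i j, isomorphic (F i) (F j) -> i = j).
Proof.
move=> noethR [locR hensel] nGor [M [/(totally_reflexiveP noethR) MT _ Mf]].
have [fin|/(infinite_TR_type)[F [FT Finj]]] := pselect (finite_TR_type R); last first.
  exists F; split=> // i; have [FiT Fii] := FT i.
  by split=> //; apply/(totally_reflexiveP noethR).
case: nGor; have [k [pi [piS piU]]] := local_residue_field noethR locR.
have piE : @submod R R^o (fun x => pi x = 0).
  split=> [|a x y x0 y0]; first exact: rmorph0.
  by rewrite rmorphD rmorphM x0 y0 mulr0 addr0.
have [K [q0 [q0S q0E]]] := quotient_exists piE.
have [X [f [XT fA fmin]]] :=
  minimal_approximation noethR piU q0S q0E piS (hensel k pi piS) fin.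
(* The projection of R onto [K] factors through [f], free modules being totally reflexive. *)
have fS : surjective f.
  have [|c cE] := @linear_of _ 'rV[R]_1 K (fun v => q0 (v 0 0)).
    by move=> a u v; rewrite !mxE -linearP.
  have [h hE] := fA _ (TR_rV R 1) c.
  move=> y; have [r <-] := q0S y; exists (h (const_mx r)).
  by rewrite hE cE mxE.
have [Y [u [uI _ uf]]] := ses_ker fS.
have [n0 n0E] := approximation_van noethR piU q0S q0E XT fS uI uf
  (wakamatsu noethR XT fA fmin uf uI) (exist _ M (conj MT Mf)).
exact: (residue_van_gorenstein noethR piU q0S q0E n0E).
Qed.
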